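(* Let $f\in C^3(\mathbb{R},\mathbb{R})$ satisfy hypotheses (H1), (H2), (H3) listed in the context. Then there exist $\epsilon=\epsilon_f>0$ and $K=K_f>0$ (depending only on $f$) such that the delay differential equation $$x'(t)=-x(t)+\zeta f(x(t-h))$$ is globally stable (every solution satisfies $x(t)\to 0$ as $t\to+\infty$) whenever $0\le \zeta-1\le\epsilon$ and $$0\le h<K(\zeta-1)^{-1/8}$$ (for $\zeta=1$ the right-hand side is read as $+\infty$). As a consequence, the function $\Gamma$ defined in the context is differentiable at $\mu=1$, and $\Gamma'(1)=0$.
   Context: Hypotheses on $f\in C^3(\mathbb{R},\mathbb{R})$: (H1) $xf(x)<0$ for all $x\neq 0$, and $f'(0)=-1$. (H2) $f$ is bounded below and there exists at most one point $x^*\in\mathbb{R}$ such that $f'(x^* )=0$; moreover, if it exists, $x^*$ is a local extremum of $f$. (H3) $(Sf)(x)<0$ for all $x\neq x^*$ (for all $x\in\mathbb{R}$ if no such $x^*$ exists), where $Sf=\frac{f'''}{f'}-\frac32\left(\frac{f''}{f'}\right)^2$ is the Schwarz derivative of $f$. Equation: for $\zeta>0$ and $h\ge 0$, consider the scalar delay differential equation $x'(t)=-x(t)+\zeta f(x(t-h))$, $x\in\mathbb{R}$, with solutions on $[0,+\infty)$ determined by arbitrary continuous initial functions on $[-h,0]$. The equation is called globally (asymptotically) stable if all its solutions converge to $0$ as $t\to+\infty$. Parameters: put $\mu=1/\zeta$ and $\nu=e^{-h}/\zeta$, so that $\zeta>0,\ h\ge 0$ corresponds to $\mu>0$, $0<\nu\le\mu$.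 Let $\mathcal{D}$ be the set of all such pairs $(\mu,\nu)$ for which the equation (with the given fixed $f$) is globally asymptotically stable. For $\mu>0$ define $$\Gamma(\mu)=\inf\{\nu\ge 0:\ \{\mu\}\times\big((\nu,+\infty)\cap(0,\mu]\big)\subset\mathcal{D}\}.$$ *)

(* Defs.v *)
From Stdlib Require Import Reals.
From Coquelicot Require Import Coquelicot.
Open Scope R_scope.

(** All intermediate derivatives are required, because [ex_derive_n f 3] alone
    says nothing about the existence of the lower ones ([Derive] is total). *)
Definition class_C3 (f : R -> R) : Prop :=
  (forall (k : nat) (x : R), (k <= 3)%nat -> ex_derive_n f k x) /\
  (forall x : R, continuous (Derive_n f 3) x).

Definition local_extremum (f : R -> R) (x : R) : Prop :=
  locally x (fun y => f x <= f y) \/ locally x (fun y => f y <= f x).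

Definition Schwarz (f : R -> R) (x : R) : R :=
  Derive_n f 3 x / Derive f x - 3 / 2 * (Derive_n f 2 x / Derive f x) ^ 2.

Definition H1 (f : R -> R) : Prop :=
  (forall x : R, x <> 0 -> x * f x < 0) /\ Derive f 0 = -1.

Definition H2 (f : R -> R) : Prop :=
  (exists m : R, forall x : R, m <= f x) /\
  (forall x y : R, Derive f x = 0 -> Derive f y = 0 -> x = y) /\
  (forall x : R, Derive f x = 0 -> local_extremum f x).

(** The excluded points are exactly the critical points; under [H2] there is at
    most one of them. *)
Definition H3 (f : R -> R) : Prop :=
  forall x : R, Derive f x <> 0 -> Schwarz f x < 0.

(** [x] solves [x'(t) = - x(t) + zeta * f (x (t - h))] on [[0, +oo)] with initial
    function [phi] on [[-h, 0]]; values of [x] and [phi] elsewhere are irrelevant.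
    At [t = 0] the equation holds for the right derivative automatically, by
    continuity of [x] on [[-h, +oo)]. *)
Definition is_solution (f : R -> R) (zeta h : R) (phi x : R -> R) : Prop :=
  (forall t : R, -h <= t <= 0 -> x t = phi t) /\
  continuous_on (fun t => -h <= t) x /\
  (forall t : R, 0 < t -> is_derive x t (- x t + zeta * f (x (t - h)))).

Definition globally_stable (f : R -> R) (zeta h : R) : Prop :=
  forall phi : R -> R, continuous_on (fun t => -h <= t <= 0) phi ->
  forall x : R -> R, is_solution f zeta h phi x -> is_lim x p_infty 0.

Definition stability_domain (f : R -> R) (mu nu : R) : Prop :=
  exists zeta h : R, 0 < zeta /\ 0 <= h /\
    mu = 1 / zeta /\ nu = exp (- h) / zeta /\ globally_stable f zeta h.

(** For [0 < mu] the set below contains [mu] and is bounded below by [0], so the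
    greatest lower bound is finite. *)
Definition Gamma (f : R -> R) (mu : R) : R :=
  real (Glb_Rbar (fun nu => 0 <= nu /\
    forall nu' : R, nu < nu' -> 0 < nu' <= mu -> stability_domain f mu nu')).

(* Main.v *)
Require Import Defs.
From Stdlib Require Import Reals Ranalysis5 Factorial Lra Lia Psatz Classical.
From Coquelicot Require Import Coquelicot.
Open Scope R_scope.

(** Negative Schwarzian gives [1/|f(x)| >= 1/|x| + b sgn x + q min(|x|,q)] with
    [b = f''(0)/2]. For a solution with [p = limsup x] and [n = limsup (-x)] the
    delay equation then yields [zeta/n >= 1/p + b + q min(p,q)] and
    [zeta/p >= 1/n - b + q min(n,q)]; adding them forces [p = n = 0] when
    [zeta <= 1], and makes [p] and [n] comparable and of order [sqrt eps] when
    [zeta = 1 + eps].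

    In the second case the deficits [u = p - x] and [l = n + x] satisfy, up to
    errors of order [eps * min(p,n)],
    [u'(t) >= - u(t) + kappa l(t - h)] and [l'(t) >= - l(t) + kappa u(t - h)]
    with [kappa] close to 1. Every window of length [h + 16] contains a time
    where [|x| <= min(p,n)/2], so both deficits are large there; after [N ~ h^2]
    delays this spreads by a gamma law of standard deviation [sqrt N ~ h], which
    keeps [u] above a multiple of [min(p,n)/N] at all later times. The errors
    only accumulate to [N eps min(p,n)], so [x] cannot approach [p]. *)

(** * Negative Schwarzian derivative *)

Lemma is_derive_continuity_pt (f : R -> R) (x l : R) :
  is_derive f x l -> continuity_pt f x.
Proof.
  intros H. apply derivable_continuous_pt. exists l. now apply is_derive_Reals.
Qed.

Lemma le_of_derive_nonneg (f df : R -> R) (a b : R) :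
  a <= b ->
  (forall t, a <= t <= b -> is_derive f t (df t)) ->
  (forall t, a <= t <= b -> 0 <= df t) ->
  f a <= f b.
Proof.
  intros Hab Hd Hp.
  destruct (MVT_gen f a b df) as [c [Hc Heq]].
  - intros t; rewrite Rmin_left, Rmax_right by lra; intros; apply Hd; lra.
  - intros t; rewrite Rmin_left, Rmax_right by lra; intros.
    eapply is_derive_continuity_pt; apply Hd; lra.
  - rewrite Rmin_left, Rmax_right in Hc by lra.
    assert (0 <= df c * (b - a)) by (apply Rmult_le_pos; [apply Hp|]; lra). lra.
Qed.

Lemma lt_of_derive_pos (f df : R -> R) (a b : R) :
  a < b ->
  (forall t, a <= t <= b -> is_derive f t (df t)) ->
  (forall t, a < t < b -> 0 < df t) ->
  f a < f b.
Proof.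
  intros Hab Hd Hp.
  destruct (MVT_cor2 f df a b Hab) as [c [Heq Hc]].
  { intros t Ht. apply is_derive_Reals, Hd, Ht. }
  assert (0 < df c * (b - a)) by (apply Rmult_lt_0_compat; [apply Hp|]; lra). lra.
Qed.

Lemma IVT_zero (f : R -> R) (a b : R) :
  a <= b -> (forall t, a <= t <= b -> continuity_pt f t) -> f a * f b <= 0 ->
  exists c, a <= c <= b /\ f c = 0.
Proof.
  intros Hab Hc Hs.
  destruct (Req_dec (f a) 0) as [H|Ha]; [exists a; split; [lra|exact H]|].
  destruct (Req_dec (f b) 0) as [H|Hb]; [exists b; split; [lra|exact H]|].
  assert (Hlt : a < b).
  { destruct Hab as [H|H]; [exact H|]. subst b. nra. }
  destruct (Rtotal_order (f a) 0) as [H|[H|H]]; [|contradiction|].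
  - destruct (IVT_interv f a b Hc Hlt H) as [c [H1 H2]]; [nra|]. now exists c.
  - destruct (IVT_interv (fun t => - f t) a b) as [c [H1 H2]]; [|lra|lra|nra|].
    + intros t Ht. apply continuity_pt_opp, Hc, Ht.
    + exists c; split; [exact H1|lra].
Qed.

(** The restriction to [[0, +oo)] of [- f] and of [x |-> f (- x)]. *)
Record hump (F F1 F2 F3 : R -> R) : Prop := {
  hump_d1 : forall x, is_derive F x (F1 x);
  hump_d2 : forall x, is_derive F1 x (F2 x);
  hump_d3 : forall x, is_derive F2 x (F3 x);
  hump_c3 : continuous F3 0;
  hump_0 : F 0 = 0;
  hump_pos : forall x, 0 < x -> 0 < F x;
  hump_slope : F1 0 = 1;
  hump_crit : forall x y, F1 x = 0 -> F1 y = 0 -> x = y;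
  hump_ext : forall x, F1 x = 0 -> local_extremum F x;
  hump_Schwarz : forall x, F1 x <> 0 -> F3 x / F1 x - 3 / 2 * (F2 x / F1 x) ^ 2 < 0
}.

(** [F1] is positive at [0] and at [x], so a nonpositive value in between would produce its only
    zero [c], with [F1] positive on both sides. Then [F] increases strictly through [c], which
    contradicts that [c] is a local extremum. *)
Lemma hump_increasing_before (F F1 F2 F3 : R -> R) (x y : R) :
  hump F F1 F2 F3 -> 0 <= y <= x -> 0 < F1 x -> 0 < F1 y.
Proof.
  intros [d1 d2 d3 _ _ _ sl cr ext _] Hy Hx.
  destruct (Rlt_le_dec 0 (F1 y)) as [H|H]; [exact H|exfalso].
  assert (C : forall t, continuity_pt F1 t).
  { intros t. eapply is_derive_continuity_pt, d2. }
  destruct (IVT_zero F1 0 y) as [c [Hc Ec]]; [lra|auto|nra|].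
  assert (c <> 0) by (intros ->; lra).
  assert (c <> x) by (intros ->; lra).
  assert (PL : forall t, 0 <= t < c -> 0 < F1 t).
  { intros t Ht. destruct (Rlt_le_dec 0 (F1 t)) as [P|P]; [exact P|].
    destruct (IVT_zero F1 0 t) as [d [Hd Ed]]; [lra|auto|nra|].
    generalize (cr _ _ Ec Ed); lra. }
  assert (PR : forall t, c < t <= x -> 0 < F1 t).
  { intros t Ht. destruct (Rlt_le_dec 0 (F1 t)) as [P|P]; [exact P|].
    destruct (IVT_zero F1 t x) as [d [Hd Ed]]; [lra|auto|nra|].
    generalize (cr _ _ Ec Ed); lra. }
  destruct (ext c Ec) as [[e He]|[e He]].
  - set (t := c - Rmin (e / 2) c).
    pose proof (cond_pos e). assert (0 < Rmin (e / 2) c) by (apply Rmin_glb_lt; lra).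
    pose proof (Rmin_l (e / 2) c). pose proof (Rmin_r (e / 2) c).
    assert (F t < F c).
    { apply lt_of_derive_pos with F1; [unfold t; lra|intros; apply d1|].
      intros s Hs; apply PL; unfold t in Hs; lra. }
    assert (F c <= F t); [|lra].
    apply He. unfold ball; simpl. unfold AbsRing_ball, abs, minus, plus, opp; simpl.
    apply Rabs_def1; unfold t; lra.
  - set (t := c + Rmin (e / 2) (x - c)).
    pose proof (cond_pos e). assert (0 < Rmin (e / 2) (x - c)) by (apply Rmin_glb_lt; lra).
    pose proof (Rmin_l (e / 2) (x - c)). pose proof (Rmin_r (e / 2) (x - c)).
    assert (F c < F t).
    { apply lt_of_derive_pos with F1; [unfold t; lra|intros; apply d1|].
      intros s Hs; apply PR; unfold t in Hs; lra. }
    assert (F t <= F c); [|lra].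
    apply He. unfold ball; simpl. unfold AbsRing_ball, abs, minus, plus, opp; simpl.
    apply Rabs_def1; unfold t; lra.
Qed.

(* With [w = F1 ^ (-1/2)], which is convex because the Schwarzian is negative,
   [k = w * F - x] satisfies [k 0 = k' 0 = 0] and [k'' = w'' * F >= 0]. *)
Lemma hump_slope_le (F F1 F2 F3 : R -> R) (x : R) :
  hump F F1 F2 F3 -> 0 < x -> F1 x * x ^ 2 <= F x ^ 2.
Proof.
  intros HF Hx.
  destruct (Rle_lt_dec (F1 x) 0) as [Hn|Hp].
  { assert (0 <= F x ^ 2) by apply pow2_ge_0. assert (0 < x ^ 2) by nra. nra. }
  assert (P : forall y, 0 <= y <= x -> 0 < F1 y).
  { intros y Hy. eapply hump_increasing_before; eauto. }
  destruct HF as [d1 d2 d3 _ F0 pos sl _ _ S].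
  set (r := fun y => sqrt (F1 y)).
  assert (rp : forall y, 0 <= y <= x -> 0 < r y) by (intros; apply sqrt_lt_R0, P; auto).
  assert (rr : forall y, 0 <= y <= x -> r y * r y = F1 y).
  { intros y Hy. apply sqrt_sqrt. left; apply P, Hy. }
  assert (dr : forall y, 0 <= y <= x -> is_derive r y (F2 y / (2 * r y))).
  { intros y Hy. apply is_derive_sqrt; [apply d2|apply P, Hy]. }
  assert (r0 : r 0 = 1) by (unfold r; rewrite sl; apply sqrt_1).
  set (k1 := fun y => - F2 y / (2 * r y ^ 3) * F y + r y - 1).
  set (k := fun y => F y / r y - y).
  assert (dk : forall y, 0 <= y <= x -> is_derive k y (k1 y)).
  { intros y Hy. unfold k, k1.
    pose proof (rp y Hy). pose proof (rr y Hy).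
    evar_last.
    { apply (is_derive_minus (fun y => F y / r y) (fun y => y)).
      - apply is_derive_div; [apply d1|apply dr, Hy|lra].
      - apply is_derive_id. }
    unfold minus, plus, opp, one; simpl. rewrite <- H0. field. lra. }
  assert (dk1 : forall y, 0 <= y <= x -> is_derive k1 y
     ((- F3 y / (2 * r y ^ 3) + 3 * F2 y ^ 2 / (4 * r y ^ 5)) * F y)).
  { intros y Hy. unfold k1.
    pose proof (rp y Hy) as Hr. pose proof (rr y Hy) as HH. pose proof (dr y Hy) as D.
    assert (E1 : ex_derive F y) by (eexists; apply d1).
    assert (E2 : ex_derive F2 y) by (eexists; apply d3).
    assert (E3 : ex_derive r y) by (eexists; apply D).
    pose proof (is_derive_unique F y _ (d1 y)) as U1.
    pose proof (is_derive_unique F2 y _ (d3 y)) as U2.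
    pose proof (is_derive_unique r y _ D) as U3.
    evar_last.
    { auto_derive; [repeat split; auto; apply Rgt_not_eq; repeat apply Rmult_lt_0_compat; lra|reflexivity]. }
    change (Derive (fun x0 => F x0) y) with (Derive F y).
    change (Derive (fun x0 => F2 x0) y) with (Derive F2 y).
    change (Derive (fun x0 => r x0) y) with (Derive r y).
    rewrite U1, U2, U3, <- HH. field. lra. }
  (* This expression is [w'']: minus the Schwarzian of [F] divided by [2 * r y]. *)
  assert (sc : forall y, 0 <= y <= x ->
     0 <= - F3 y / (2 * r y ^ 3) + 3 * F2 y ^ 2 / (4 * r y ^ 5)).
  { intros y Hy. pose proof (P y Hy) as Py. pose proof (rp y Hy) as Hr. pose proof (rr y Hy) as HH.
    pose proof (S y (Rgt_not_eq _ _ Py)) as Sy.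
    replace (- F3 y / (2 * r y ^ 3) + 3 * F2 y ^ 2 / (4 * r y ^ 5))
      with (- (F3 y / F1 y - 3 / 2 * (F2 y / F1 y) ^ 2) * / (2 * r y)).
    - apply Rmult_le_pos; [lra|]. left. apply Rinv_0_lt_compat. lra.
    - rewrite <- HH. field. lra. }
  assert (F_nn : forall y, 0 <= y -> 0 <= F y).
  { intros y [Hy|<-]; [left; auto|lra]. }
  assert (k1_nn : forall y, 0 <= y <= x -> 0 <= k1 y).
  { intros y Hy. replace 0 with (k1 0).
    - apply le_of_derive_nonneg with (fun y =>
       (- F3 y / (2 * r y ^ 3) + 3 * F2 y ^ 2 / (4 * r y ^ 5)) * F y); [lra| |].
      + intros t Ht; apply dk1; lra.
      + intros t Ht; apply Rmult_le_pos; [apply sc|apply F_nn]; lra.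
    - unfold k1. rewrite F0, r0. ring. }
  assert (k_nn : 0 <= k x).
  { replace 0 with (k 0).
    - apply le_of_derive_nonneg with k1; [lra|auto|auto].
    - unfold k. rewrite F0. unfold Rdiv. ring. }
  unfold k in k_nn.
  assert (Hr : 0 < r x) by (apply rp; lra).
  assert (x * r x <= F x).
  { replace (F x) with (F x / r x * r x) by (field; lra).
    apply Rmult_le_compat_r; lra. }
  rewrite <- (rr x) by lra. assert (0 < x * r x) by nra. nra.
Qed.

(** As [F1 0 = 1], the Schwarzian inequality at [0] reads [F3 0 / 6 < (F2 0 / 2) ^ 2]. With [c] the
    midpoint, continuity of [F3] at [0] gives [F3 <= 6 * c] near [0], and three integrations give
    the cubic bound. The gap left above [c] is the source of the gain [q] in the reciprocal
    bounds. *)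
Lemma hump_Taylor (F F1 F2 F3 : R -> R) :
  hump F F1 F2 F3 ->
  exists c d, c < (F2 0 / 2) ^ 2 /\ 0 < d /\
    forall x, 0 <= x <= d -> F x <= x + F2 0 / 2 * x ^ 2 + c * x ^ 3.
Proof.
  intros [d1 d2 d3 C3 F0 _ sl _ _ S].
  assert (S0 : F3 0 < 6 * (F2 0 / 2) ^ 2).
  { assert (N : F1 0 <> 0) by lra. generalize (S 0 N). rewrite sl.
    unfold Rdiv; rewrite Rinv_1, !Rmult_1_r. intros. nra. }
  set (c := (F3 0 / 6 + (F2 0 / 2) ^ 2) / 2). exists c.
  assert (Hc : F3 0 < 6 * c) by (unfold c; lra).
  destruct (C3 (fun y => y < 6 * c)) as [d Hd].
  { apply open_lt, Hc. }
  exists (d / 2). pose proof (cond_pos d). split; [unfold c; lra|split; [lra|]].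
  assert (H3 : forall t, 0 <= t <= d / 2 -> F3 t <= 6 * c).
  { intros t Ht. left. apply Hd. unfold ball; simpl.
    unfold AbsRing_ball, abs, minus, plus, opp; simpl. apply Rabs_def1; lra. }
  set (g2 := fun t => F2 0 + 6 * c * t - F2 t).
  set (g1 := fun t => 1 + F2 0 * t + 3 * c * t ^ 2 - F1 t).
  set (g := fun t => t + F2 0 / 2 * t ^ 2 + c * t ^ 3 - F t).
  assert (dg2 : forall t, is_derive g2 t (6 * c - F3 t)).
  { intros t. unfold g2. evar_last.
    { apply (is_derive_minus (fun t => F2 0 + 6 * c * t)); [auto_derive; [auto|reflexivity]|apply d3]. }
    unfold minus, plus, opp; simpl; ring. }
  assert (dg1 : forall t, is_derive g1 t (g2 t)).
  { intros t. unfold g1. evar_last.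
    { apply (is_derive_minus (fun t => 1 + F2 0 * t + 3 * c * t ^ 2)); [auto_derive; [auto|reflexivity]|apply d2]. }
    unfold g2, minus, plus, opp; simpl; ring. }
  assert (dg : forall t, is_derive g t (g1 t)).
  { intros t. unfold g. evar_last.
    { apply (is_derive_minus (fun t => t + F2 0 / 2 * t ^ 2 + c * t ^ 3)); [auto_derive; [auto|reflexivity]|apply d1]. }
    unfold g1, minus, plus, opp; simpl; field. }
  assert (p2 : forall t, 0 <= t <= d / 2 -> 0 <= g2 t).
  { intros t Ht. replace 0 with (g2 0) by (unfold g2; ring).
    apply le_of_derive_nonneg with (fun t => 6 * c - F3 t); [lra|auto|].
    intros s Hs. specialize (H3 s). lra. }
  assert (p1 : forall t, 0 <= t <= d / 2 -> 0 <= g1 t).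
  { intros t Ht. replace 0 with (g1 0) by (unfold g1; rewrite sl; ring).
    apply le_of_derive_nonneg with g2; [lra|auto|]. intros s Hs. apply p2; lra. }
  intros x Hx. assert (0 <= g x); [|unfold g in *; lra].
  replace 0 with (g 0) by (unfold g; rewrite F0; ring).
  apply le_of_derive_nonneg with g1; [lra|auto|]. intros s Hs. apply p1; lra.
Qed.

(* [y |-> 1 / F (1 / y)] is compared with the translation by [- F2 0 / 2], the
   reciprocal form of the Moebius map with the same 2-jet at [0]. *)
Lemma hump_inv_lower (F F1 F2 F3 : R -> R) :
  hump F F1 F2 F3 ->
  exists q0, 0 < q0 /\ forall q, 0 < q <= q0 -> forall x, 0 < x ->
    / x - F2 0 / 2 + q * Rmin x q <= / F x.
Proof.
  intros HF.
  destruct (hump_Taylor _ _ _ _ HF) as (c & d & Hc & Hd & HT).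
  set (b := - (F2 0 / 2)). replace ((F2 0 / 2) ^ 2) with (b ^ 2) in Hc by (unfold b; ring).
  (* [1 / (x - b x^2 + c x^3) = 1/x + b + (b^2 - c) x + ...]. Half of the linear coefficient is
     kept; the other half absorbs the higher-order terms for [x <= x0], by the choice of [D]. *)
  set (p := (b ^ 2 - c) / 2). assert (Hp : 0 < p) by (unfold p; lra).
  set (D := Rabs (b * c - p * b) + Rabs (p * c) + 1).
  assert (HD : 1 <= D).
  { unfold D. pose proof (Rabs_pos (b * c - p * b)). pose proof (Rabs_pos (p * c)). lra. }
  set (x0 := Rmin (Rmin d 1) (p / D)).
  assert (Hx0 : 0 < x0).
  { unfold x0. repeat apply Rmin_glb_lt; try lra. apply Rdiv_lt_0_compat; lra. }
  assert (x0 <= d /\ x0 <= 1 /\ x0 * D <= p) as (B1 & B2 & B3).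
  { unfold x0. pose proof (Rmin_l (Rmin d 1) (p / D)). pose proof (Rmin_r (Rmin d 1) (p / D)).
    pose proof (Rmin_l d 1). pose proof (Rmin_r d 1). repeat split; try lra.
    replace p with (p / D * D) at 2 by (field; lra). apply Rmult_le_compat_r; lra. }
  assert (near : forall x, 0 < x <= x0 -> / x + b + p * x <= / F x).
  { intros x Hx. pose proof (hump_pos _ _ _ _ HF x ltac:(lra)) as FP.
    apply Rmult_le_reg_r with (F x); [exact FP|]. rewrite Rinv_l by lra.
    destruct (Rle_lt_dec (/ x + b + p * x) 0) as [N|N]; [nra|].
    apply Rle_trans with ((/ x + b + p * x) * (x - b * x ^ 2 + c * x ^ 3)).
    { apply Rmult_le_compat_l; [lra|]. generalize (HT x ltac:(lra)). unfold b. lra. }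
    replace ((/ x + b + p * x) * (x - b * x ^ 2 + c * x ^ 3))
      with (1 + x ^ 2 * (- p + (b * c - p * b) * x + p * c * x ^ 2)) by (unfold p; field; lra).
    assert ((b * c - p * b) * x + p * c * x ^ 2 <= p).
    { apply Rle_trans with (Rabs (b * c - p * b) * x + Rabs (p * c) * x).
      - pose proof (Rle_abs (b * c - p * b)). pose proof (Rle_abs (p * c)).
        pose proof (Rabs_pos (p * c)). assert (x ^ 2 <= x) by nra. assert (0 <= x^2) by nra. nra.
      - unfold D in B3. nra. }
    assert (0 <= x ^ 2) by nra. nra. }
  (* By [hump_slope_le] the difference [1 / F - 1 / x] is nondecreasing, so the excess reached at
     [x0] persists. *)
  assert (far : forall x, x0 <= x -> / x0 + b + p * x0 - / x0 <= / F x - / x).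
  { intros x Hx. apply Rle_trans with (/ F x0 - / x0).
    { generalize (near x0 ltac:(lra)); lra. }
    apply (le_of_derive_nonneg (fun t => / F t - / t) (fun t => - F1 t / F t ^ 2 - - 1 / t ^ 2)); [lra| |].
    - intros t Ht. apply (is_derive_minus (fun t => / F t) (fun t => / t)).
      + apply is_derive_inv; [apply (hump_d1 _ _ _ _ HF)|].
        apply Rgt_not_eq, (hump_pos _ _ _ _ HF); lra.
      + auto_derive; [lra|field; lra].
    - intros t Ht. pose proof (hump_pos _ _ _ _ HF t ltac:(lra)).
      pose proof (hump_slope_le _ _ _ _ t HF ltac:(lra)).
      replace (- F1 t / F t ^ 2 - - 1 / t ^ 2) with ((F t ^ 2 - F1 t * t ^ 2) * / (F t ^ 2 * t ^ 2))
        by (field; lra).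
      apply Rmult_le_pos; [lra|]. left. apply Rinv_0_lt_compat. apply Rmult_lt_0_compat; apply pow_lt; lra. }
  (* With [q <= p] and [q <= x0], the term [q * Rmin x q] is at most [p * x] in the near region and
     at most [p * x0] in the far one. *)
  exists (Rmin p x0). split; [now apply Rmin_glb_lt|].
  intros q Hq x Hx.
  pose proof (Rmin_l p x0). pose proof (Rmin_r p x0).
  pose proof (Rmin_l x q). pose proof (Rmin_r x q).
  assert (0 < Rmin x q) by (apply Rmin_glb_lt; lra).
  destruct (Rle_lt_dec x x0) as [L|L].
  - generalize (near x (conj Hx L)). unfold b. assert (q * Rmin x q <= p * x) by nra. lra.
  - generalize (far x ltac:(lra)). unfold b. assert (q * Rmin x q <= p * x0) by nra. lra.
Qed.

(** The derivative-free form of the hypotheses used for the dynamics: [b] will be [f''(0) / 2], [q]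
    measures the gain from the strict Schwarzian inequality, and [L] controls how far the slope
    departs from [-1] on [[-rho, rho]]. The record survives [f(y) |-> - f(-y)] with [b] replaced by
    [- b], so every estimate on [limsup x] also yields one on [limsup (- x)]. *)
Record feedback (f : R -> R) (b q L rho : R) : Prop := {
  fb_0 : f 0 = 0;
  fb_neg : forall y, 0 < y -> f y < 0;
  fb_pos : forall y, 0 < y -> 0 < f (- y);
  fb_q : 0 < q <= 1;
  fb_L : 0 <= L;
  fb_rho : 0 < rho;
  fb_inv_neg : forall y, 0 < y -> / y + b + q * Rmin y q <= / - f y;
  fb_inv_pos : forall y, 0 < y -> / y - b + q * Rmin y q <= / f (- y);
  fb_lip : forall r y1 y2, r <= rho -> - r <= y1 -> y1 <= y2 -> y2 <= r ->
    (1 - L * r) * (y2 - y1) <= f y1 - f y2 <= 2 * (y2 - y1)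
}.

Lemma feedback_opp (f : R -> R) (b q L rho : R) :
  feedback f b q L rho -> feedback (fun y => - f (- y)) (- b) q L rho.
Proof.
  intros [f0 neg pos Hq HL Hr invn invp lip]; split; auto.
  - rewrite Ropp_0, f0; ring.
  - intros y Hy; generalize (pos y Hy); lra.
  - intros y Hy; rewrite Ropp_involutive; generalize (neg y Hy); lra.
  - intros y Hy; rewrite Ropp_involutive; apply (invp y Hy).
  - intros y Hy; rewrite Ropp_involutive.
    replace (/ y - - b) with (/ y + b) by ring. apply (invn y Hy).
  - intros r y1 y2 H1 H2 H3 H4.
    generalize (lip r (- y2) (- y1) H1 ltac:(lra) ltac:(lra) ltac:(lra)). lra.
Qed.

(** Near [0] the difference quotients of [f1] lie within [1] of [l], whence [L = |l| + 1]. The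
    radius is cut to [1 / L] so that [f1 >= -2] there, the source of the constant [2] in
    [fb_lip]. *)
Lemma derive_near_m1 (f1 : R -> R) (l : R) :
  is_derive f1 0 l -> f1 0 = -1 ->
  exists L rho, 0 <= L /\ 0 < rho /\ L * rho <= 1 /\
    forall y, Rabs y <= rho -> Rabs (f1 y + 1) <= L * Rabs y.
Proof.
  intros Hd H1. apply is_derive_Reals in Hd.
  destruct (Hd 1 Rlt_0_1) as [d Hd1]. pose proof (cond_pos d).
  set (L := Rabs l + 1). assert (1 <= L) by (unfold L; generalize (Rabs_pos l); lra).
  exists L, (Rmin (d / 2) (/ L)).
  assert (0 < / L) by (apply Rinv_0_lt_compat; lra).
  pose proof (Rmin_l (d / 2) (/ L)). pose proof (Rmin_r (d / 2) (/ L)).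
  split; [lra|split; [apply Rmin_glb_lt; lra|split]].
  - apply Rle_trans with (L * / L); [apply Rmult_le_compat_l; lra|].
    rewrite Rinv_r; lra.
  - intros y Hy. destruct (Req_dec y 0) as [->|N].
    { rewrite H1, Rabs_R0. replace (-1 + 1) with 0 by ring. rewrite Rabs_R0. lra. }
    generalize (Hd1 y N ltac:(lra)). rewrite Rplus_0_l, H1. intros B.
    replace (f1 y + 1) with (((f1 y - -1) / y) * y) by (field; exact N).
    rewrite Rabs_mult. apply Rmult_le_compat_r; [apply Rabs_pos|].
    unfold L. replace ((f1 y - -1) / y) with (l + ((f1 y - -1) / y - l)) by ring.
    eapply Rle_trans; [apply Rabs_triang|]. lra.
Qed.

Lemma class_C3_derivatives (f : R -> R) :
  class_C3 f ->
  (forall x, is_derive f x (Derive f x)) /\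
  (forall x, is_derive (Derive f) x (Derive_n f 2 x)) /\
  (forall x, is_derive (Derive_n f 2) x (Derive_n f 3 x)).
Proof.
  intros [H _]. split; [|split]; intros x.
  - exact (Derive_correct _ _ (H 1%nat x ltac:(lia))).
  - exact (Derive_correct _ _ (H 2%nat x ltac:(lia))).
  - exact (Derive_correct _ _ (H 3%nat x ltac:(lia))).
Qed.

Lemma negative_feedback_zero (f : R -> R) :
  (forall x, x <> 0 -> x * f x < 0) -> continuous f 0 -> f 0 = 0.
Proof.
  intros Hs Hc.
  destruct (Rtotal_order (f 0) 0) as [H|[H|H]]; [exfalso|exact H|exfalso].
  - destruct (Hc (fun y => y < 0)) as [d Hd]; [now apply open_lt|].
    pose proof (cond_pos d).
    assert (f (- (d / 2)) < 0).
    { apply Hd. unfold ball; simpl. unfold AbsRing_ball, abs, minus, plus, opp; simpl.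
      apply Rabs_def1; lra. }
    generalize (Hs (- (d / 2)) ltac:(lra)). nra.
  - destruct (Hc (fun y => 0 < y)) as [d Hd]; [now apply open_gt|].
    pose proof (cond_pos d).
    assert (0 < f (d / 2)).
    { apply Hd. unfold ball; simpl. unfold AbsRing_ball, abs, minus, plus, opp; simpl.
      apply Rabs_def1; lra. }
    generalize (Hs (d / 2) ltac:(lra)). nra.
Qed.

Lemma local_extremum_opp (f : R -> R) (x : R) :
  local_extremum f x -> local_extremum (fun y => - f y) x.
Proof.
  intros [H|H]; [right|left]; revert H; apply filter_imp; intros; lra.
Qed.

Lemma local_extremum_reflect (f : R -> R) (x : R) :
  local_extremum f (- x) -> local_extremum (fun y => f (- y)) x.
Proof.
  assert (L : forall P, locally (- x) P -> locally x (fun y => P (- y))).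
  { intros P. exact (continuous_opp (fun y : R => y) x (continuous_id x) P). }
  intros [H|H]; [left|right]; apply L in H; exact H.
Qed.

Lemma is_derive_reflect (g : R -> R) (x l : R) :
  is_derive g (- x) l -> is_derive (fun y => g (- y)) x (- l).
Proof.
  intros H. evar_last.
  - apply (is_derive_comp g (fun y => - y)); [exact H|].
    auto_derive; [auto|reflexivity].
  - unfold scal; simpl; unfold mult; simpl. ring.
Qed.

(** The Schwarzian is invariant under both sign changes, so [- f] and [x |-> f (- x)] are both
    humps. Their second derivatives at [0] are opposite, which is why [b] enters the two reciprocal
    bounds with opposite signs. *)
Lemma feedback_intro (f : R -> R) :
  class_C3 f -> H1 f -> H2 f -> H3 f ->
  exists b q L rho, feedback f b q L rho.
Proof.
  intros C [Hs Hm1] (_ & Hu & He) HS.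
  destruct (class_C3_derivatives f C) as (d1 & d2 & d3).
  assert (f0 : f 0 = 0).
  { apply negative_feedback_zero; [exact Hs|]. apply (ex_derive_continuous f).
    eexists; apply d1. }
  assert (neg : forall y, 0 < y -> f y < 0).
  { intros y Hy; generalize (Hs y ltac:(lra)); nra. }
  assert (pos : forall y, 0 < y -> 0 < f (- y)).
  { intros y Hy; generalize (Hs (- y) ltac:(lra)); nra. }
  unfold H3, Defs.Schwarz in HS.
  assert (HF : hump (fun x => - f x) (fun x => - Derive f x)
                 (fun x => - Derive_n f 2 x) (fun x => - Derive_n f 3 x)).
  { split.
    - intros x; apply (is_derive_opp f), d1.
    - intros x; apply (is_derive_opp (Derive f)), d2.
    - intros x; apply (is_derive_opp (Derive_n f 2)), d3.
    - apply (continuous_opp (Derive_n f 3)), C.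
    - lra.
    - intros x Hx; generalize (neg x Hx); lra.
    - lra.
    - intros x y Hx Hy; apply Hu; lra.
    - intros x Hx; apply local_extremum_opp, He; lra.
    - intros x Hx. assert (N : Derive f x <> 0) by lra. generalize (HS x N).
      replace (- Derive_n f 3 x / - Derive f x) with (Derive_n f 3 x / Derive f x) by (field; lra).
      replace (- Derive_n f 2 x / - Derive f x) with (Derive_n f 2 x / Derive f x) by (field; lra).
      auto. }
  assert (HG : hump (fun x => f (- x)) (fun x => - Derive f (- x))
                 (fun x => Derive_n f 2 (- x)) (fun x => - Derive_n f 3 (- x))).
  { split.
    - intros x. apply is_derive_reflect, d1.
    - intros x. evar_last.
      { apply (is_derive_opp (fun x => Derive f (- x))), is_derive_reflect, d2. }
      unfold opp; simpl; ring.
    - intros x; apply is_derive_reflect, d3.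
    - apply (continuous_opp (fun x => Derive_n f 3 (- x))).
      apply (continuous_comp (fun y : R => - y) (Derive_n f 3)).
      + apply (continuous_opp (fun y : R => y)), continuous_id.
      + apply C.
    - rewrite Ropp_0; exact f0.
    - exact pos.
    - rewrite Ropp_0; lra.
    - intros x y Hx Hy. assert (- x = - y) by (apply Hu; lra). lra.
    - intros x Hx; apply local_extremum_reflect, He; lra.
    - intros x Hx. assert (N : Derive f (- x) <> 0) by lra. generalize (HS (- x) N).
      replace (- Derive_n f 3 (- x) / - Derive f (- x))
        with (Derive_n f 3 (- x) / Derive f (- x)) by (field; lra).
      replace ((Derive_n f 2 (- x) / - Derive f (- x)) ^ 2)
        with ((Derive_n f 2 (- x) / Derive f (- x)) ^ 2) by (field; lra).
      auto. }
  destruct (hump_inv_lower _ _ _ _ HF) as (q1 & Hq1 & I1).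
  destruct (hump_inv_lower _ _ _ _ HG) as (q2 & Hq2 & I2).
  destruct (derive_near_m1 (Derive f) _ (d2 0) Hm1) as (L & rho & HL & Hr & HLr & HD).
  exists (Derive_n f 2 0 / 2), (Rmin 1 (Rmin q1 q2)), L, rho.
  set (q := Rmin 1 (Rmin q1 q2)).
  assert (0 < q) by (unfold q; repeat apply Rmin_glb_lt; lra).
  assert (q <= 1 /\ q <= q1 /\ q <= q2) as (K1 & K2 & K3).
  { unfold q. pose proof (Rmin_l 1 (Rmin q1 q2)). pose proof (Rmin_r 1 (Rmin q1 q2)).
    pose proof (Rmin_l q1 q2). pose proof (Rmin_r q1 q2). lra. }
  split; auto; try lra.
  - intros y Hy. generalize (I1 q ltac:(lra) y Hy). cbv beta. lra.
  - intros y Hy. generalize (I2 q ltac:(lra) y Hy). cbv beta. rewrite Ropp_0. lra.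
  - intros r y1 y2 H1 H2 H4 H5.
    assert (B : forall t, y1 <= t <= y2 -> -2 <= Derive f t <= -1 + L * r).
    { intros t Ht.
      assert (Rabs t <= r) by (apply Rabs_le; lra).
      generalize (HD t ltac:(lra)); intros K.
      pose proof (Rle_abs (Derive f t + 1)). pose proof (Rle_abs (- (Derive f t + 1))) as K'.
      rewrite Rabs_Ropp in K'. pose proof (Rabs_pos t).
      assert (L * Rabs t <= L * r) by (apply Rmult_le_compat_l; lra).
      assert (L * Rabs t <= L * rho) by (apply Rmult_le_compat_l; lra). lra. }
    split.
    + assert (- f y1 - (1 - L * r) * y1 <= - f y2 - (1 - L * r) * y2); [|lra].
      apply (le_of_derive_nonneg (fun t => - f t - (1 - L * r) * t)
              (fun t => - Derive f t - (1 - L * r))); [exact H4| |].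
      * intros t _. apply (is_derive_minus (fun t => - f t)).
        -- apply (is_derive_opp f), d1.
        -- auto_derive; [auto|ring].
      * intros t Ht. generalize (B t Ht). lra.
    + assert (f y1 + 2 * y1 <= f y2 + 2 * y2); [|lra].
      apply (le_of_derive_nonneg (fun t => f t + 2 * t) (fun t => Derive f t + 2)); [exact H4| |].
      * intros t _. apply (is_derive_plus f); [apply d1|].
        auto_derive; [auto|ring].
      * intros t Ht. generalize (B t Ht). lra.
Qed.

(** * Upper and lower limits of solutions *)

Definition delay_eq (f : R -> R) (zeta h : R) (x : R -> R) : Prop :=
  forall t, 0 < t -> is_derive x t (- x t + zeta * f (x (t - h))).

Definition is_limsup (x : R -> R) (p : R) : Prop :=
  (forall eta, 0 < eta -> exists T, forall t, T <= t -> x t <= p + eta) /\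
  (forall eta T, 0 < eta -> exists t, T <= t /\ p - eta <= x t).

Lemma delay_eq_opp (f : R -> R) (zeta h : R) (x : R -> R) :
  delay_eq f zeta h x -> delay_eq (fun y => - f (- y)) zeta h (fun t => - x t).
Proof.
  intros H t Ht. evar_last.
  - apply (is_derive_opp x), H, Ht.
  - unfold opp; simpl. rewrite !Ropp_involutive. ring.
Qed.

Lemma is_limsup_opp_opp (x : R -> R) (p : R) :
  is_limsup x p -> is_limsup (fun t => - - x t) p.
Proof.
  intros [H1 H2]; split.
  - intros eta He. destruct (H1 eta He) as [T HT]. exists T. intros t Ht.
    rewrite Ropp_involutive; auto.
  - intros eta T He. destruct (H2 eta T He) as [t Ht]. exists t.
    rewrite Ropp_involutive; auto.
Qed.

(** The limit superior is the infimum of the eventual upper bounds; since [completeness] yields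
    suprema, it is obtained as minus the supremum of their negatives. *)
Lemma is_limsup_exists (x : R -> R) (A B T : R) :
  (forall t, T <= t -> A <= x t <= B) -> exists p, is_limsup x p.
Proof.
  intros H.
  destruct (completeness (fun y => exists S, forall t, S <= t -> x t <= - y)) as [l [Hl1 Hl2]].
  - exists (- A). intros y [S HS].
    generalize (HS (Rmax S T) (Rmax_l S T)) (H (Rmax S T) (Rmax_r S T)). lra.
  - exists (- B), T. intros t Ht. generalize (H t Ht). lra.
  - exists (- l); split.
    + intros eta He.
      destruct (classic (exists y, (exists S, forall t, S <= t -> x t <= - y) /\ l - eta < y))
        as [(y & [S HS] & Hy)|N].
      * exists S. intros t Ht. generalize (HS t Ht). lra.
      * assert (l <= l - eta); [|lra]. apply Hl2. intros y Hy.
        destruct (Rle_lt_dec y (l - eta)) as [K|K]; [exact K|]. exfalso; apply N; eauto.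
    + intros eta S He.
      destruct (classic (exists t, S <= t /\ - l - eta <= x t)) as [K|N]; [exact K|].
      assert (l + eta <= l); [|lra]. apply Hl1. exists S. intros t Ht.
      destruct (Rle_lt_dec (x t) (- (l + eta))) as [K|K]; [exact K|].
      exfalso; apply N. exists t; split; lra.
Qed.

Lemma exp_weight_le (d d1 : R -> R) (a b : R) :
  a <= b ->
  (forall t, a <= t <= b -> is_derive d t (d1 t)) ->
  (forall t, a <= t <= b -> - d t <= d1 t) ->
  exp a * d a <= exp b * d b.
Proof.
  intros Hab Hd Hp.
  apply (le_of_derive_nonneg (fun t => exp t * d t) (fun t => exp t * d t + exp t * d1 t)); [exact Hab| |].
  - intros t Ht. apply (is_derive_mult exp d t); [apply is_derive_exp|apply Hd, Ht|].
    intros; apply Rmult_comm.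
  - intros t Ht. generalize (Hp t Ht) (exp_pos t). nra.
Qed.

(** Since [exp t * (G - x t)] is nondecreasing, the excess of [x] over [G] decays exponentially. By
    [1 + s <= exp s], waiting for a time [C / eta] is enough. *)
Lemma delay_eq_eventually_le (f : R -> R) (zeta h : R) (x : R -> R) (G T : R) :
  delay_eq f zeta h x ->
  (forall t, T <= t -> zeta * f (x (t - h)) <= G) ->
  forall eta, 0 < eta -> exists T', forall t, T' <= t -> x t <= G + eta.
Proof.
  intros HE HG eta He.
  set (T1 := Rmax T 1). pose proof (Rmax_l T 1). pose proof (Rmax_r T 1).
  set (C := Rabs (x T1 - G)). pose proof (Rabs_pos (x T1 - G)). pose proof (Rle_abs (x T1 - G)).
  assert (0 <= C / eta) by (apply Rdiv_le_0_compat; [exact H1|exact He]).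
  exists (T1 + C / eta). intros t Ht.
  assert (M : exp T1 * (G - x T1) <= exp t * (G - x t)).
  { apply (exp_weight_le (fun t => G - x t) (fun t => - (- x t + zeta * f (x (t - h))))); [lra| |].
    - intros s Hs. evar_last.
      { apply (is_derive_minus (fun _ => G) x); [apply is_derive_const|apply HE].
        fold T1 in H0; lra. }
      unfold minus, plus, opp, zero; simpl. ring.
    - intros s Hs. generalize (HG s). fold T1 in H. intros K. specialize (K ltac:(lra)). lra. }
  replace t with (T1 + (t - T1)) in M at 1 by ring. rewrite exp_plus in M.
  pose proof (exp_pos T1) as Pe. pose proof (exp_ineq1_le (t - T1)) as E.
  assert (M' : exp T1 * (G - x T1) <= exp T1 * (exp (t - T1) * (G - x t))) by lra.
  apply Rmult_le_reg_l in M'; [|exact Pe].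
  assert (C <= (t - T1) * eta).
  { replace C with (C / eta * eta) by (field; lra). apply Rmult_le_compat_r; lra. }
  fold C in H1, H2.
  destruct (Rle_lt_dec (x t) (G + eta)) as [K|K]; [exact K|exfalso].
  assert (exp (t - T1) * (G - x t) <= (1 + (t - T1)) * (G - x t)) by nra. nra.
Qed.

(** Below [q] the slope [- 1 / s^2 + q] is nonpositive because [s < q <= 1]; above [q] only [1 / s]
    varies. This makes the reciprocal bound at [v] valid for every smaller argument. *)
Lemma inv_add_min_decreasing (q s v : R) :
  0 < q <= 1 -> 0 < s <= v -> / v + q * Rmin v q <= / s + q * Rmin s q.
Proof.
  intros Hq Hs.
  assert (Hv : / v <= / s) by (apply Rinv_le_contravar; lra).
  destruct (Rle_lt_dec q s) as [K|K].
  - rewrite !Rmin_right by lra. lra.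
  - rewrite (Rmin_left s q) by lra.
    assert (HM : q * Rmin v q - q * s <= / s - / Rmin v q).
    { assert (s <= Rmin v q) by (apply Rmin_glb; lra).
      assert (Rmin v q <= 1) by (generalize (Rmin_r v q); lra).
      set (m := Rmin v q) in *.
      replace (/ s - / m) with ((m - s) * / (s * m)) by (field; lra).
      assert (1 <= / (s * m)).
      { rewrite <- Rinv_1. apply Rinv_le_contravar; nra. }
      nra. }
    assert (/ v <= / Rmin v q).
    { apply Rinv_le_contravar; [apply Rmin_glb_lt; lra|apply Rmin_l]. }
    lra.
Qed.

(** For positive [v > n] the solution eventually stays above [- v], so the feedback is at most
    [zeta / P] with [P] the reciprocal bound at [v] (if [P > 0]), and hence [p <= zeta / P]. Then
    [v] decreases to [n]. *)
Lemma limsup_recip (f : R -> R) (b q L rho zeta h : R) (x : R -> R) (p n : R) :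
  feedback f b q L rho -> 0 < zeta -> 0 <= h -> delay_eq f zeta h x ->
  is_limsup x p -> is_limsup (fun t => - x t) n ->
  0 < p -> 0 < n /\ / n - b + q * Rmin n q <= zeta / p.
Proof.
  intros HF Hz Hh HE [_ Hp] [Hn _] pp.
  pose proof (fb_q _ _ _ _ _ HF) as Hq.
  assert (zp : 0 < zeta / p) by (apply Rdiv_lt_0_compat; lra).
  assert (A : forall v, 0 < v -> n < v -> / v - b + q * Rmin v q <= zeta / p).
  { intros v Hv Hnv. set (P := / v - b + q * Rmin v q).
    destruct (Rle_lt_dec P 0) as [K|K]; [lra|].
    destruct (Hn (v - n) ltac:(lra)) as [T HT].
    assert (B : forall y, - v <= y -> zeta * f y <= zeta / P).
    { intros y Hy. apply Rmult_le_compat_l; [lra|].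
      assert (0 < / P) by (apply Rinv_0_lt_compat; exact K).
      destruct (Rlt_le_dec y 0) as [Y|Y].
      - generalize (fb_inv_pos _ _ _ _ _ HF (- y) ltac:(lra)) (fb_pos _ _ _ _ _ HF (- y) ltac:(lra)).
        rewrite Ropp_involutive. intros I1 I2.
        generalize (inv_add_min_decreasing q (- y) v Hq ltac:(lra)). intros I3.
        rewrite <- (Rinv_inv (f y)). apply Rinv_le_contravar; [exact K|]. unfold P. lra.
      - destruct Y as [Y|<-].
        + generalize (fb_neg _ _ _ _ _ HF y Y). lra.
        + rewrite (fb_0 _ _ _ _ _ HF). lra. }
    assert (p <= zeta / P).
    { apply le_epsilon. intros eta He.
      destruct (delay_eq_eventually_le f zeta h x (zeta / P) (T + h) HE) with (eta := eta / 2) as [T' HT'].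
      - intros t Ht. apply B. generalize (HT (t - h) ltac:(lra)). lra.
      - lra.
      - destruct (Hp (eta / 2) T') as [t [Ht1 Ht2]]; [lra|]. generalize (HT' t Ht1). lra. }
    apply Rmult_le_reg_r with p; [exact pp|].
    apply Rle_trans with (P * (zeta / P)); [apply Rmult_le_compat_l; lra|].
    right; field; lra. }
  assert (np : 0 < n).
  { destruct (Rlt_le_dec 0 n) as [K|K]; [exact K|exfalso].
    (* If [n <= 0], every [v > 0] is admissible in [A]; at [v = 1 / w] its left-hand side exceeds
       [zeta / p]. *)
    set (w := zeta / p + Rabs b + 1).
    assert (0 < w) by (unfold w; generalize (Rabs_pos b); lra).
    assert (0 < / w) by (apply Rinv_0_lt_compat; lra).
    generalize (A (/ w) ltac:(lra) ltac:(lra)). rewrite Rinv_inv.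
    assert (0 < Rmin (/ w) q) by (apply Rmin_glb_lt; lra).
    pose proof (Rle_abs b).
    assert (0 < q * Rmin (/ w) q) by (apply Rmult_lt_0_compat; lra).
    unfold w at 1. lra. }
  split; [exact np|].
  set (C := zeta / p + b - q * Rmin n q).
  assert (A' : forall v, n < v -> / v <= C).
  { intros v Hv. generalize (A v ltac:(lra) Hv). unfold C.
    assert (Rmin n q <= Rmin v q) by (apply Rle_min_compat_r; lra). nra. }
  assert (0 < C).
  { apply Rlt_le_trans with (/ (n + 1)); [apply Rinv_0_lt_compat; lra|apply A'; lra]. }
  assert (0 < / n) by (apply Rinv_0_lt_compat; lra).
  destruct (Rle_lt_dec (/ n) C) as [K|K]; [unfold C in K; lra|exfalso].
  (* If [C < 1 / n], the inverse of their midpoint is a [v > n] that violates [A']. *)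
  assert (n < / ((C + / n) / 2)).
  { rewrite <- (Rinv_inv n) at 1. apply Rinv_lt_contravar; [apply Rmult_lt_0_compat; lra|lra]. }
  generalize (A' _ H1). rewrite Rinv_inv. lra.
Qed.

(** The lower bound of [f] bounds [x] below first. From then on the delayed argument is either
    positive, where [f < 0], or in a compact interval, where [f <= B]; this bounds [x] above. *)
Lemma delay_eq_bounded (f : R -> R) (b q L rho zeta h m B : R) (x : R -> R) :
  feedback f b q L rho -> 0 < zeta -> delay_eq f zeta h x ->
  (forall y, m <= f y) -> (forall y, zeta * m - 1 <= y <= 0 -> f y <= B) ->
  exists A' B' T, forall t, T <= t -> A' <= x t <= B'.
Proof.
  intros HF Hz HE Hm HB.
  destruct (delay_eq_eventually_le _ _ h _ (- (zeta * m)) 0 (delay_eq_opp _ _ _ _ HE)) with (eta := 1) as [T HT].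
  - intros t _. rewrite Ropp_involutive. generalize (Hm (x (t - h))). nra.
  - lra.
  - destruct (delay_eq_eventually_le _ _ h x (zeta * Rmax B 0) (T + h) HE) with (eta := 1) as [T' HT'].
    + intros t Ht. apply Rmult_le_compat_l; [lra|].
      generalize (HT (t - h) ltac:(lra)). intros K.
      destruct (Rlt_le_dec 0 (x (t - h))) as [Y|Y].
      * generalize (fb_neg _ _ _ _ _ HF _ Y) (Rmax_r B 0). lra.
      * apply Rle_trans with B; [apply HB; lra|apply Rmax_l].
    + lra.
    + exists (zeta * m - 1), (zeta * Rmax B 0 + 1), (Rmax T T').
      intros t Ht. pose proof (Rmax_l T T'). pose proof (Rmax_r T T').
      generalize (HT t ltac:(lra)) (HT' t ltac:(lra)). lra.
Qed.

Lemma is_lim_of_limsup (x : R -> R) (p n : R) :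
  is_limsup x p -> is_limsup (fun t => - x t) n -> p <= 0 -> n <= 0 -> is_lim x p_infty 0.
Proof.
  intros [H1 _] [H2 _] Hp Hn. apply is_lim_spec. intros eps.
  pose proof (cond_pos eps).
  destruct (H1 (eps / 2)) as [T1 K1]; [lra|]. destruct (H2 (eps / 2)) as [T2 K2]; [lra|].
  exists (Rmax T1 T2). intros t Ht. pose proof (Rmax_l T1 T2). pose proof (Rmax_r T1 T2).
  generalize (K1 t ltac:(lra)) (K2 t ltac:(lra)). intros. apply Rabs_def1; lra.
Qed.

Lemma solution_limsups (f : R -> R) (b q L rho zeta h m : R) (phi x : R -> R) :
  feedback f b q L rho -> (forall y, continuity_pt f y) -> (forall y, m <= f y) ->
  0 < zeta -> is_solution f zeta h phi x ->
  delay_eq f zeta h x /\ exists p n, is_limsup x p /\ is_limsup (fun t => - x t) n.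
Proof.
  intros HF Hc Hm Hz (_ & _ & HE). split; [exact HE|].
  assert (Hm0 : m <= 0) by (rewrite <- (fb_0 _ _ _ _ _ HF); apply Hm).
  destruct (continuity_ab_maj f (zeta * m - 1) 0) as (M & HM & _); [nra|auto|].
  destruct (delay_eq_bounded f b q L rho zeta h m (f M) x HF Hz HE Hm HM) as (A' & B' & T & HT).
  destruct (is_limsup_exists x A' B' T HT) as [p Hp].
  destruct (is_limsup_exists (fun t => - x t) (- B') (- A') T) as [n Hn].
  - intros t Ht; generalize (HT t Ht); lra.
  - exists p, n; auto.
Qed.

Lemma limsups_recip (f : R -> R) (b q L rho zeta h : R) (x : R -> R) (p n : R) :
  feedback f b q L rho -> 0 < zeta -> 0 <= h -> delay_eq f zeta h x ->
  is_limsup x p -> is_limsup (fun t => - x t) n ->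
  (p <= 0 /\ n <= 0) \/
  (0 < p /\ 0 < n /\ / n - b + q * Rmin n q <= zeta / p /\ / p + b + q * Rmin p q <= zeta / n).
Proof.
  intros HF Hz Hh HE Hp Hn.
  pose proof (limsup_recip _ _ _ _ _ _ _ _ p n HF Hz Hh HE Hp Hn) as K1.
  pose proof (limsup_recip _ _ _ _ _ _ _ _ n p (feedback_opp _ _ _ _ _ HF) Hz Hh
    (delay_eq_opp _ _ _ _ HE) Hn (is_limsup_opp_opp _ _ Hp)) as K2.
  destruct (Rlt_le_dec 0 p) as [P|P]; [right|left].
  - destruct (K1 P) as [N1 I1]. destruct (K2 N1) as [_ I2]. repeat split; lra.
  - split; [exact P|]. destruct (Rlt_le_dec 0 n) as [N|N]; [|exact N].
    destruct (K2 N). lra.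
Qed.

Lemma stable_le_1 (f : R -> R) (b q L rho zeta h m : R) :
  feedback f b q L rho -> (forall y, continuity_pt f y) -> (forall y, m <= f y) ->
  0 < zeta <= 1 -> 0 <= h -> globally_stable f zeta h.
Proof.
  intros HF Hc Hm Hz Hh phi _ x Hx.
  destruct (solution_limsups f b q L rho zeta h m phi x HF Hc Hm ltac:(lra) Hx) as (HE & p & n & Hp & Hn).
  destruct (limsups_recip f b q L rho zeta h x p n HF ltac:(lra) Hh HE Hp Hn) as [[P N]|(P & N & I1 & I2)].
  - eapply is_lim_of_limsup; eauto.
  - exfalso. pose proof (fb_q _ _ _ _ _ HF) as Hq.
    assert (0 < Rmin n q) by (apply Rmin_glb_lt; lra).
    assert (0 < Rmin p q) by (apply Rmin_glb_lt; lra).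
    assert (0 < / p) by (apply Rinv_0_lt_compat; lra).
    assert (0 < / n) by (apply Rinv_0_lt_compat; lra).
    unfold Rdiv in *. nra.
Qed.

(** * Spreading of the deficits *)

(** For [t >= 0], the density of the gamma law of shape [n + 1] and rate [1]; [n = 0] is the
    exponential law. *)
Definition gamma_density (n : nat) (t : R) : R := t ^ n * exp (- t) / INR (fact n).

Lemma is_derive_gamma_density (n : nat) (t : R) :
  is_derive (gamma_density (S n)) t (gamma_density n t - gamma_density (S n) t).
Proof.
  unfold gamma_density. pose proof (INR_fact_neq_0 n). pose proof (not_0_INR (S n) ltac:(lia)).
  evar_last.
  - auto_derive; [exact I|reflexivity].
  - change (match n with 0%nat => 1 | S _ => INR n + 1 end) with (INR (S n)).
    change (fact n + n * fact n)%nat with (S n * fact n)%nat.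
    rewrite <- (tech_pow_Rmult t n), fact_simpl, mult_INR. simpl Init.Nat.pred. field. auto.
Qed.

Lemma pow_exp (x : R) (n : nat) : exp x ^ n = exp (INR n * x).
Proof.
  induction n as [|n IH].
  - simpl. rewrite Rmult_0_l, exp_0. reflexivity.
  - rewrite <- tech_pow_Rmult, IH, <- exp_plus, S_INR. f_equal. ring.
Qed.

Lemma exp_nondecreasing (x y : R) : x <= y -> exp x <= exp y.
Proof.
  intros [H| ->]; [left; now apply exp_increasing|lra].
Qed.

(** A crude Stirling bound, [a! <= a^(a+1) * e^(1-a)] for [a = n + 1]. It exceeds the true size by a
    factor of order [sqrt a], so the density below is bounded by a multiple of [1 / a] only. *)
Lemma fact_le_pow (n : nat) :
  INR (fact (S n)) <= INR (S n) ^ S (S n) * exp (- INR n).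
Proof.
  induction n as [|n IH].
  - simpl. rewrite Ropp_0, exp_0. lra.
  - rewrite fact_simpl, mult_INR.
    set (a := INR (S n)) in *. replace (INR (S (S n))) with (a + 1) by (unfold a; rewrite <- S_INR; reflexivity).
    assert (Ha : 0 < a) by (unfold a; apply lt_0_INR; lia).
    replace (INR n) with (a - 1) in IH by (unfold a; rewrite S_INR; ring).
    rewrite <- (tech_pow_Rmult (a + 1) (S (S n))), Rmult_assoc.
    apply Rmult_le_compat_l; [lra|].
    apply Rle_trans with (1 := IH).
    replace (- (a - 1)) with (1 + - a) by ring. rewrite exp_plus, <- Rmult_assoc.
    apply Rmult_le_compat_r; [left; apply exp_pos|].
    (* [e <= (1 + 1/a) ^ (a + 1)] since [exp (- 1/(a+1)) >= a/(a+1)] *)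
    assert (E : exp 1 * (a / (a + 1)) ^ S (S n) <= 1).
    { apply Rle_trans with (exp 1 * exp (- (1 / (a + 1))) ^ S (S n)).
      - apply Rmult_le_compat_l; [left; apply exp_pos|].
        apply pow_incr. split; [apply Rdiv_le_0_compat; lra|].
        generalize (exp_ineq1_le (- (1 / (a + 1)))). intros K.
        replace (a / (a + 1)) with (1 + - (1 / (a + 1))) by (field; lra). exact K.
      - rewrite pow_exp. replace (INR (S (S n))) with (a + 1) by (unfold a; rewrite <- S_INR; reflexivity).
        rewrite <- exp_plus. replace (1 + _) with 0 by (field; lra). rewrite exp_0; lra. }
    replace a with (a / (a + 1) * (a + 1)) at 1 by (field; lra).
    rewrite Rpow_mult_distr.
    assert (0 < (a + 1) ^ S (S n)) by (apply pow_lt; lra). nra.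
Qed.

(** Up to one [sqrt a] to the right of its mode [a], the function [t^a * e^(-t)] loses at most a
    factor [e]: with [u = (t - a) / t], [a / t <= e^(-u)] and [a * u >= t - a - 1]. Dividing by the
    bound on [a!] leaves [1 / (e^2 * a)], and [e^2 <= 9]. *)
Lemma gamma_density_lower (n : nat) (t : R) :
  0 <= t - INR (S n) -> (t - INR (S n)) ^ 2 <= INR (S n) ->
  1 / (9 * INR (S n)) <= gamma_density (S n) t.
Proof.
  set (a := INR (S n)). intros H1 H2.
  assert (Ha : 0 < a) by (unfold a; apply lt_0_INR; lia).
  unfold gamma_density.
  pose proof (fact_le_pow n) as HF. fold a in HF.
  replace (INR n) with (a - 1) in HF by (unfold a; rewrite S_INR; ring).
  pose proof (INR_fact_lt_0 (S n)) as Hf.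
  assert (E : a ^ S n * exp (- a) * exp (-1) <= t ^ S n * exp (- t)).
  { set (u := (t - a) / t). assert (Ht : 0 < t) by lra.
    assert (K : a / t <= exp (- u)).
    { generalize (exp_ineq1_le (- u)). replace (a / t) with (1 + - u) by (unfold u; field; lra). auto. }
    assert (K2 : a ^ S n <= t ^ S n * exp (- (a * u))).
    { replace (exp (- (a * u))) with (exp (- u) ^ S n).
      - rewrite <- Rpow_mult_distr. apply pow_incr. split; [lra|].
        replace a with (t * (a / t)) by (field; lra). apply Rmult_le_compat_l; lra.
      - rewrite pow_exp. fold a. f_equal. ring. }
    assert (K3 : exp (- (a * u)) * (exp (- a) * exp (-1)) <= exp (- t)).
    { rewrite <- !exp_plus. apply exp_nondecreasing.
      assert (a * u = t - a - (t - a) ^ 2 / t) by (unfold u; field; lra).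
      assert ((t - a) ^ 2 / t <= 1).
      { apply Rle_div_l; lra. }
      lra. }
    rewrite Rmult_assoc.
    apply Rle_trans with (t ^ S n * exp (- (a * u)) * (exp (- a) * exp (-1))).
    - apply Rmult_le_compat_r; [|exact K2].
      left; apply Rmult_lt_0_compat; apply exp_pos.
    - rewrite Rmult_assoc. apply Rmult_le_compat_l; [left; apply pow_lt; lra|exact K3]. }
  apply (proj1 (Rle_div_r _ _ _ Hf)).
  apply Rle_trans with (1 / (9 * a) * (a ^ S (S n) * exp (- (a - 1)))).
  { apply Rmult_le_compat_l; [|exact HF]. apply Rdiv_le_0_compat; lra. }
  apply Rle_trans with (2 := E).
  replace (- (a - 1)) with (- a + -1 + 2) by ring. rewrite !exp_plus.
  replace (1 / (9 * a) * (a ^ S (S n) * (exp (- a) * exp (-1) * exp 2)))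
    with (a ^ S n * exp (- a) * exp (-1) * (exp 2 / 9)) by (simpl; field; lra).
  assert (exp 2 <= 9).
  { replace 2 with (1 + 1) by ring. rewrite exp_plus. generalize exp_le_3 (exp_pos 1). nra. }
  assert (0 < a ^ S n * exp (- a) * exp (-1)).
  { pose proof (pow_lt a (S n) Ha). pose proof (exp_pos (- a)). pose proof (exp_pos (-1)).
    apply Rmult_lt_0_compat; [apply Rmult_lt_0_compat|]; assumption. }
  nra.
Qed.

Lemma exp_weight_nonneg (d d1 : R -> R) (a b : R) :
  a <= b -> 0 <= d a ->
  (forall t, a <= t <= b -> is_derive d t (d1 t)) ->
  (forall t, a <= t <= b -> - d t <= d1 t) -> 0 <= d b.
Proof.
  intros Hab Ha Hd Hp. pose proof (exp_weight_le d d1 a b Hab Hd Hp).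
  pose proof (exp_pos a). pose proof (exp_pos b). nra.
Qed.

(** [gamma_density (S n)] solves [y' = - y + gamma_density n] and vanishes at [0], so the difference
    [d] between [v] and its claimed bound starts nonnegative and satisfies [d' >= - d]. The error
    grows by one [e] because [kappa <= 1]. *)
Lemma gamma_propagation_step (v v1 w : R -> R) (h kappa A e a : R) (n : nat) :
  0 <= kappa <= 1 -> 0 <= e -> 0 <= v a ->
  (forall t, a <= t -> is_derive v t (v1 t)) ->
  (forall t, a <= t -> - v t + kappa * w (t - h) - e <= v1 t) ->
  (forall t, a <= t -> A * gamma_density n (t - a) - (INR n + 1) * e <= w (t - h)) ->
  forall t, a <= t -> kappa * A * gamma_density (S n) (t - a) - (INR (S n) + 1) * e <= v t.
Proof.
  intros Hk He Ha Hd Hv Hw t Ht.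
  set (d := fun t => v t - (kappa * A * gamma_density (S n) (t - a) - (INR (S n) + 1) * e)).
  assert (0 <= d t); [|unfold d in *; lra].
  pose proof (pos_INR n).
  apply (exp_weight_nonneg d (fun t => v1 t - kappa * A * (gamma_density n (t - a) - gamma_density (S n) (t - a))) a t Ht).
  - unfold d. rewrite S_INR. unfold gamma_density. replace (a - a) with 0 by ring.
    rewrite pow_i by lia. unfold Rdiv. rewrite !Rmult_0_l, Rmult_0_r.
    assert (0 <= (INR n + 1 + 1) * e) by (apply Rmult_le_pos; lra). lra.
  - intros s Hs. unfold d. apply (is_derive_minus v); [apply Hd; lra|].
    evar_last.
    { apply (is_derive_minus (fun t => kappa * A * gamma_density (S n) (t - a)) (fun _ => (INR (S n) + 1) * e)).
      - apply (is_derive_scal (fun t => gamma_density (S n) (t - a))).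
        apply (is_derive_comp (gamma_density (S n)) (fun t => t - a)); [apply is_derive_gamma_density|].
        auto_derive; [auto|reflexivity].
      - apply is_derive_const. }
    unfold minus, plus, opp, zero, scal; simpl; unfold mult; simpl. ring.
  - intros s Hs. unfold d. generalize (Hv s ltac:(lra)) (Hw s ltac:(lra)). rewrite S_INR.
    intros K1 K2.
    assert (kappa * (A * gamma_density n (s - a) - (INR n + 1) * e) <= kappa * w (s - h))
      by (apply Rmult_le_compat_l; lra).
    assert (kappa * ((INR n + 1) * e) <= (INR n + 1) * e).
    { assert (0 <= (INR n + 1) * e) by (apply Rmult_le_pos; lra). nra. }
    lra.
Qed.

(* The linear comparison system convolves the deficits [u], [l] with an
   exponential law at each delay, so after [n] delays with a gamma law. *)
Lemma gamma_propagation (u l u1 l1 : R -> R) (T h kappa A e z : R) :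
  0 <= kappa <= 1 -> 0 <= e -> 0 <= h -> T + h <= z ->
  (forall t, T <= t -> 0 <= u t /\ 0 <= l t) ->
  (forall t, T + h <= t -> is_derive u t (u1 t) /\ is_derive l t (l1 t)) ->
  (forall t, T + h <= t -> - u t + kappa * l (t - h) - e <= u1 t) ->
  (forall t, T + h <= t -> - l t + kappa * u (t - h) - e <= l1 t) ->
  A <= u z -> A <= l z ->
  forall n t, z + INR n * h <= t ->
    kappa ^ n * A * gamma_density n (t - (z + INR n * h)) - (INR n + 1) * e <= u t /\
    kappa ^ n * A * gamma_density n (t - (z + INR n * h)) - (INR n + 1) * e <= l t.
Proof.
  intros Hk He Hh Hz Hp Hd Hu Hl Au Al.
  (* Before any delay has elapsed, the nonnegative term [kappa * w (t - h)] is dropped: from its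
     value at [z], [v] decays no faster than exponentially, up to [e]. *)
  assert (base : forall v v1 w, A <= v z -> (forall t, T <= t -> 0 <= w t) ->
     (forall t, T + h <= t -> is_derive v t (v1 t)) ->
     (forall t, T + h <= t -> - v t + kappa * w (t - h) - e <= v1 t) ->
     forall t, z <= t -> A * gamma_density 0 (t - z) - e <= v t).
  { intros v v1 w Hv Hw Dv Dv1 t Ht.
    set (d := fun t => v t - (A * gamma_density 0 (t - z) - e)).
    assert (0 <= d t); [|unfold d in *; lra].
    apply (exp_weight_nonneg d (fun t => v1 t + A * gamma_density 0 (t - z)) z t Ht).
    - unfold d, gamma_density. simpl. replace (- (z - z)) with 0 by ring. rewrite exp_0. lra.
    - intros s Hs. unfold d.
      assert (E : ex_derive v s) by (eexists; apply Dv; lra).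
      pose proof (is_derive_unique v s _ (Dv s ltac:(lra))) as U.
      unfold gamma_density. simpl. auto_derive; [repeat split; auto|].
      change (Derive (fun x => v x) s) with (Derive v s). rewrite U. unfold Rminus. field.
    - intros s Hs. unfold d. generalize (Dv1 s ltac:(lra)) (Hw (s - h) ltac:(lra)).
      intros K1 K2. assert (0 <= kappa * w (s - h)) by (apply Rmult_le_pos; lra). lra. }
  induction n as [|n IH]; intros t Ht.
  - simpl INR in *. rewrite Rmult_0_l, Rplus_0_r in *. simpl pow. rewrite !Rmult_1_l, Rplus_0_l, !Rmult_1_l.
    split.
    + apply (base u u1 l); auto; intros; [apply Hp|apply Hd]; auto.
    + apply (base l l1 u); auto; intros; [apply Hp|apply Hd]; auto.
  - assert (E : z + INR (S n) * h = z + INR n * h + h) by (rewrite S_INR; ring).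
    assert (0 <= INR n * h) by (apply Rmult_le_pos; [apply pos_INR|exact Hh]).
    simpl pow. rewrite (Rmult_assoc kappa (kappa ^ n) A).
    set (a := z + INR (S n) * h) in *.
    assert (IH' : forall s, a <= s ->
      kappa ^ n * A * gamma_density n (s - a) - (INR n + 1) * e <= u (s - h) /\
      kappa ^ n * A * gamma_density n (s - a) - (INR n + 1) * e <= l (s - h)).
    { intros s Hs. replace (s - a) with (s - h - (z + INR n * h)) by lra. apply IH. lra. }
    split.
    + apply (gamma_propagation_step u u1 l h); auto.
      * apply Hp; lra.
      * intros s Hs; apply Hd; lra.
      * intros s Hs; apply Hu; lra.
      * intros s Hs; apply IH', Hs.
    + apply (gamma_propagation_step l l1 u h); auto.
      * apply Hp; lra.
      * intros s Hs; apply Hd; lra.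
      * intros s Hs; apply Hl; lra.
      * intros s Hs; apply IH', Hs.
Qed.

(** * * Exclusion of persistent oscillations for zeta slightly above 1 *)

Lemma delay_eq_not_large (f : R -> R) (b q L rho zeta h s a : R) (x : R -> R) :
  feedback f b q L rho -> 0 < zeta -> 0 <= h -> delay_eq f zeta h x -> 0 < s -> 0 < a ->
  (forall t, a <= t -> x t <= 5 * s) ->
  (forall t, a <= t <= a + h + 16 -> s / 2 < x t) -> False.
Proof.
  intros HF Hz Hh HE Hs Ha HU HL.
  (* From [a + h] on the feedback is negative, so [x' <= - s / 2]. Over [16] time units [x] loses
     [8 * s], more than the available [5 * s]. *)
  assert (x (a + h + 16) + s / 2 * (a + h + 16) <= x (a + h) + s / 2 * (a + h)).
  { apply Ropp_le_cancel.
    apply (le_of_derive_nonneg (fun t => - (x t + s / 2 * t))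
       (fun t => - ((- x t + zeta * f (x (t - h))) + s / 2))); [lra| |].
    - intros t Ht. apply (is_derive_opp (fun t => x t + s / 2 * t)).
      apply (is_derive_plus x); [apply HE; lra|]. auto_derive; [auto|ring].
    - intros t Ht. generalize (HL t ltac:(lra)) (HL (t - h) ltac:(lra)). intros K1 K2.
      pose proof (fb_neg _ _ _ _ _ HF (x (t - h)) ltac:(lra)). nra. }
  generalize (HU (a + h) ltac:(lra)) (HL (a + h + 16) ltac:(lra)). lra.
Qed.

(** Otherwise [x] has no zero on the window, hence keeps one sign by the intermediate value theorem,
    and [delay_eq_not_large] applies to [x] or to [- x]. *)
Lemma delay_eq_small_somewhere (f : R -> R) (b q L rho zeta h s a : R) (x : R -> R) :
  feedback f b q L rho -> 0 < zeta -> 0 <= h -> delay_eq f zeta h x -> 0 < s -> 0 < a ->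
  (forall t, a <= t -> - (5 * s) <= x t <= 5 * s) ->
  exists z, a <= z <= a + h + 16 /\ - (s / 2) <= x z <= s / 2.
Proof.
  intros HF Hz Hh HE Hs Ha HB.
  apply NNPP. intros N.
  assert (Hc : forall t, a <= t -> continuity_pt x t).
  { intros t Ht. eapply is_derive_continuity_pt, HE. lra. }
  assert (N' : forall t, a <= t <= a + h + 16 -> x t < - (s / 2) \/ s / 2 < x t).
  { intros t Ht. destruct (Rlt_le_dec (x t) (- (s / 2))) as [K|K]; [now left|right].
    destruct (Rlt_le_dec (s / 2) (x t)) as [K'|K']; [exact K'|].
    exfalso; apply N; exists t; lra. }
  assert (C : forall t, a <= t <= a + h + 16 -> 0 < x a * x t).
  { intros t Ht. destruct (Rlt_le_dec 0 (x a * x t)) as [K|K]; [exact K|exfalso].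
    destruct (IVT_zero x a t) as [c [Hc1 Hc2]]; [lra| |exact K|].
    - intros c Hc'; apply Hc; lra.
    - destruct (N' c); lra. }
  destruct (N' a) as [K|K]; [lra| |].
  - apply (delay_eq_not_large _ _ _ _ _ zeta h s a (fun t => - x t) (feedback_opp _ _ _ _ _ HF) Hz Hh (delay_eq_opp _ _ _ _ HE)); auto.
    + intros t Ht; generalize (HB t Ht); lra.
    + intros t Ht. destruct (N' t Ht); [lra|]. generalize (C t Ht). nra.
  - apply (delay_eq_not_large _ _ _ _ _ zeta h s a x HF Hz Hh HE); auto.
    + intros t Ht; generalize (HB t Ht); lra.
    + intros t Ht. destruct (N' t Ht); [|lra]. generalize (C t Ht). nra.
Qed.

(* Both bounds come from [1/n - b + q min(n,q) <= (1+eps)/p] and its mirror image: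
   their sum bounds [min(p,n)], each alone then bounds the other number. *)
Lemma recip_system_bounds (b q eps p n : R) :
  0 < q <= 1 -> 0 <= eps <= 1 -> 2 * eps < q ^ 3 -> 8 * b ^ 2 * eps <= q ->
  0 < p -> 0 < n ->
  / n - b + q * Rmin n q <= (1 + eps) / p -> / p + b + q * Rmin p q <= (1 + eps) / n ->
  let s := Rmin p n in q * s ^ 2 <= 2 * eps /\ p <= 4 * s /\ n <= 4 * s.
Proof.
  assert (main : forall b q eps p n, 0 < q <= 1 -> 0 <= eps <= 1 -> 2 * eps < q ^ 3 ->
    8 * b ^ 2 * eps <= q -> 0 < p -> p <= n ->
    / n - b + q * Rmin n q <= (1 + eps) / p -> / p + b + q * Rmin p q <= (1 + eps) / n ->
    q * p ^ 2 <= 2 * eps /\ n <= 4 * p).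
  { clear. intros b q eps p n Hq He He2 Hb Hp Hpn I1 I2.
    assert (Hpp : 0 < / p) by (apply Rinv_0_lt_compat; lra).
    assert (Hnn : 0 < / n) by (apply Rinv_0_lt_compat; lra).
    assert (Hle : / n <= / p) by (apply Rinv_le_contravar; lra).
    assert (0 < Rmin n q) by (apply Rmin_glb_lt; lra).
    assert (0 < Rmin p q) by (apply Rmin_glb_lt; lra).
    assert (S1 : q * Rmin p q <= 2 * eps * / p).
    { unfold Rdiv in *. assert (0 < q * Rmin n q) by (apply Rmult_lt_0_compat; lra). nra. }
    assert (S2 : q * Rmin p q * p <= 2 * eps).
    { replace (2 * eps) with (2 * eps * / p * p) by (field; lra). apply Rmult_le_compat_r; lra. }
    assert (S3 : q * p ^ 2 <= 2 * eps).
    { destruct (Rle_lt_dec q p) as [K|K].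
      - rewrite Rmin_right in S2 by lra. nra.
      - rewrite Rmin_left in S2 by lra. nra. }
    split; [exact S3|].
    (* From [p^2 <= 2 * eps / q] and [8 * b^2 * eps <= q]. The term [b] then costs at most half of
       [1 / p], and [1 + eps <= 2] gives [1 / p <= 4 / n]. *)
    assert (B : Rabs b * p <= / 2).
    { apply Rsqr_incr_0_var; [|lra]. unfold Rsqr.
      replace (Rabs b * p * (Rabs b * p)) with (b ^ 2 * p ^ 2).
      - assert (0 <= b ^ 2) by apply pow2_ge_0.
        assert (q * (b ^ 2 * p ^ 2) <= q / 4) by nra. nra.
      - rewrite <- (pow2_abs b). ring. }
    assert (B2 : - b <= / 2 * / p).
    { apply Rle_trans with (Rabs b); [rewrite <- Rabs_Ropp; apply Rle_abs|].
      replace (Rabs b) with (Rabs b * p * / p) by (field; lra). apply Rmult_le_compat_r; lra. }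
    assert (B3 : / p <= 4 * / n).
    { assert (0 < q * Rmin p q) by (apply Rmult_lt_0_compat; lra).
      unfold Rdiv in I2. nra. }
    apply Rmult_le_reg_r with (/ n * / p); [apply Rmult_lt_0_compat; lra|].
    replace (n * (/ n * / p)) with (/ p) by (field; lra).
    replace (4 * p * (/ n * / p)) with (4 * / n) by (field; lra). exact B3. }
  intros Hq He He2 Hb Hp Hn I1 I2 s. unfold s.
  destruct (Rle_lt_dec p n) as [K|K].
  - rewrite Rmin_left by exact K.
    destruct (main b q eps p n) as [M1 M2]; auto. repeat split; lra.
  - rewrite Rmin_right by lra.
    destruct (main (- b) q eps n p) as [M1 M2]; auto; try lra.
Qed.

(** Combining the hypothesis on [1 / p + b] with [1 / n - b <= 1 / f (- n)] cancels [b] up to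
    [eps * b]. The strongest upward push on [x] therefore exceeds [p] only by a relative error of
    order [eps]. *)
Lemma feedback_twice_le (f : R -> R) (b q L rho eps p n : R) :
  feedback f b q L rho -> 0 <= eps <= / 8 -> Rabs b * p <= 2 -> 0 < p -> 0 < n ->
  / p + b <= (1 + eps) / n -> (1 + eps) * f (- n) <= p * (1 + 8 * eps).
Proof.
  intros HF He Hb Hp Hn I.
  pose proof (fb_inv_pos _ _ _ _ _ HF n Hn) as J.
  pose proof (fb_pos _ _ _ _ _ HF n Hn) as P.
  pose proof (fb_q _ _ _ _ _ HF) as Hq.
  assert (0 < q * Rmin n q) by (apply Rmult_lt_0_compat; [|apply Rmin_glb_lt]; lra).
  set (F := f (- n)) in *.
  assert (I' : / p + b <= (1 + eps) * / n) by exact I.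
  assert (J' : / p - eps * b <= (1 + eps) * / F) by nra.
  assert (bp : b * p <= 2).
  { apply Rle_trans with (2 := Hb). apply Rmult_le_compat_r; [lra|apply Rle_abs]. }
  assert (K : (1 - eps * (b * p)) * F <= (1 + eps) * p).
  { replace ((1 - eps * (b * p)) * F) with ((/ p - eps * b) * (p * F)) by (field; lra).
    replace ((1 + eps) * p) with ((1 + eps) * / F * (p * F)) by (field; lra).
    apply Rmult_le_compat_r; [|exact J']. left; apply Rmult_lt_0_compat; lra. }
  assert (K2 : (1 - 2 * eps) * F <= (1 + eps) * p).
  { apply Rle_trans with (2 := K). apply Rmult_le_compat_r; [lra|]. nra. }
  (* The constant [8] suffices: the inequality amounts to [17 * eps^2 <= 4 * eps]. *)
  assert ((1 + eps) ^ 2 <= (1 - 2 * eps) * (1 + 8 * eps)) by nra.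
  apply Rmult_le_reg_l with (1 - 2 * eps); [lra|].
  apply Rle_trans with ((1 + eps) ^ 2 * p); nra.
Qed.

(* Here [y] stands for [x (t - h)] and [x] for [x t]; the right-hand side is the
   derivative of the upper deficit [p + eta - x]. *)
Lemma deficit_ineq (f : R -> R) (b q L rho eps p n eta y x : R) :
  feedback f b q L rho -> 0 <= eps <= 1 -> 0 < eta -> 0 < n ->
  (1 + eps) * f (- n) <= p * (1 + 8 * eps) ->
  p + eta <= rho -> n + eta <= rho -> - (n + eta) <= y <= p + eta ->
  forall kappa, 0 <= kappa -> kappa <= 1 - L * Rmax (p + eta) (n + eta) ->
  - (p + eta - x) + kappa * (n + eta + y) - (8 * eps * p + 3 * eta)
    <= - (- x + (1 + eps) * f y).
Proof.
  intros HF He Ht Hn HT H1 H2 Hy kappa Hk HK.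
  pose proof (fb_lip _ _ _ _ _ HF) as lip.
  set (r := Rmax (p + eta) (n + eta)) in *.
  assert (p + eta <= r) by apply Rmax_l. assert (n + eta <= r) by apply Rmax_r.
  assert (r <= rho) by (apply Rmax_lub; lra).
  (* The lower slope bound is used from [- (n + eta)] to [y], the upper one from [- (n + eta)] to
     [- n]. With [1 + eps <= 2] the latter costs [4 * eta], one of which is already in the deficit
     [p + eta - x]. *)
  generalize (lip r (- (n + eta)) y ltac:(lra) ltac:(lra) ltac:(lra) ltac:(lra)). intros [A _].
  generalize (lip r (- (n + eta)) (- n) ltac:(lra) ltac:(lra) ltac:(lra) ltac:(lra)). intros [_ B].
  assert (C : kappa * (y - - (n + eta)) <= (1 - L * r) * (y - - (n + eta)))
    by (apply Rmult_le_compat_r; lra).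
  assert (D : f y <= f (- n) + 2 * eta - kappa * (n + eta + y)) by lra.
  assert (0 <= kappa * (n + eta + y)) by (apply Rmult_le_pos; lra).
  assert ((1 + eps) * f y <= (1 + eps) * f (- n) + 4 * eta - kappa * (n + eta + y)) by nra.
  lra.
Qed.

Lemma pow_one_sub_ge (x : R) (n : nat) : 0 <= x <= 1 -> 1 - INR n * x <= (1 - x) ^ n.
Proof.
  intros Hx. induction n as [|n IH]; [simpl; lra|].
  rewrite <- tech_pow_Rmult, S_INR. pose proof (pos_INR n).
  assert ((1 - x) * (1 - INR n * x) <= (1 - x) * (1 - x) ^ n) by (apply Rmult_le_compat_l; lra).
  assert (0 <= INR n * x * x) by (repeat apply Rmult_le_pos; lra). nra.
Qed.

Lemma ceil_succ (r : R) : 0 <= r -> exists k, r <= INR (S k) <= r + 1.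
Proof.
  intros Hr. destruct (nfloor_ex r Hr) as [k Hk]. exists k. rewrite S_INR. lra.
Qed.

(** At a late time [ts] with [x ts >= p - eta] the upper deficit is at most [2 * eta]. Yet both
    deficits are at least [s / 2] at some earlier [z], and propagation over [S N] delays leaves at
    least [s / (36 * a) - (a + 1) * e] at [ts]. *)
Lemma no_oscillation (f : R -> R) (b q L rho eps h p n : R) (N : nat) (x : R -> R) :
  feedback f b q L rho -> 0 <= eps <= / 8 -> 0 <= h -> delay_eq f (1 + eps) h x ->
  is_limsup x p -> is_limsup (fun t => - x t) n -> 0 < p -> 0 < n ->
  (1 + eps) * f (- n) <= p * (1 + 8 * eps) ->
  (1 + eps) * - f p <= n * (1 + 8 * eps) ->
  let s := Rmin p n in
  p <= 4 * s -> n <= 4 * s -> 5 * s <= rho ->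
  (h + 16) ^ 2 <= INR (S N) -> INR (S N) * (5 * L * s) <= / 2 ->
  4608 * eps * INR (S N) ^ 2 <= 1 -> False.
Proof.
  intros HF He Hh HE [Hp1 Hp2] [Hn1 _] pp np I1 I2 s ps ns Hr HN HL HNe.
  set (a := INR (S N)) in *.
  assert (Ha : 1 <= a) by (unfold a; rewrite S_INR; generalize (pos_INR N); lra).
  assert (sp : 0 < s) by (apply Rmin_glb_lt; lra).
  assert (s_p : s <= p) by apply Rmin_l. assert (s_n : s <= n) by apply Rmin_r.
  pose proof (fb_L _ _ _ _ _ HF) as L0.
  (* In [3 * a + 5], the part [3 * (a + 1)] is the accumulated share of [eta] in the errors, and [2]
     is the deficit at [ts]. *)
  set (eta := s / (144 * a * (3 * a + 5))).
  assert (Hden : 144 <= 144 * a * (3 * a + 5)) by nra.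
  assert (Heta : 0 < eta) by (apply Rdiv_lt_0_compat; lra).
  assert (Eeta : (3 * a + 5) * eta = s / (144 * a)) by (unfold eta; field; lra).
  assert (Heta_s : eta <= s).
  { apply Rle_div_l; [lra|]. nra. }
  destruct (Hp1 eta Heta) as [T1 K1]. destruct (Hn1 eta Heta) as [T2 K2].
  set (T := Rmax 1 (Rmax T1 T2)).
  assert (1 <= T /\ T1 <= T /\ T2 <= T) as (B0 & B1 & B2).
  { unfold T. pose proof (Rmax_l 1 (Rmax T1 T2)). pose proof (Rmax_r 1 (Rmax T1 T2)).
    pose proof (Rmax_l T1 T2). pose proof (Rmax_r T1 T2). lra. }
  assert (Bd : forall t, T <= t -> - (n + eta) <= x t <= p + eta).
  { intros t Ht. generalize (K1 t ltac:(lra)) (K2 t ltac:(lra)). lra. }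
  destruct (Hp2 eta (T + h + a * h + a + h + 16) Heta) as [ts [Hts1 Hts2]].
  assert (0 <= a * h) by (apply Rmult_le_pos; lra).
  (* For any [z] in [[w, w + h + 16]], the time left after [a] delays lies in [[a, a + h + 16]], the
     range of [gamma_density_lower] since [(h + 16)^2 <= a]. *)
  set (w := ts - a * h - a - h - 16).
  destruct (delay_eq_small_somewhere f b q L rho (1 + eps) h s w x HF) as [z [Hz1 Hz2]]; auto; try lra.
  { unfold w; lra. }
  { intros t Ht. generalize (Bd t). unfold w in Ht. lra. }
  unfold w in Hz1.
  set (kappa := 1 - 5 * L * s).
  assert (HLs : 0 <= 5 * L * s <= / 2).
  { assert (0 <= 5 * L * s) by (repeat apply Rmult_le_pos; lra). split; [lra|]. nra. }
  assert (Hk : 0 <= kappa <= 1) by (unfold kappa; lra).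
  assert (HkM : forall r, r <= 5 * s -> kappa <= 1 - L * r) by (intros r Hr'; unfold kappa; nra).
  assert (M1 : Rmax (p + eta) (n + eta) <= 5 * s) by (apply Rmax_lub; lra).
  assert (M2 : Rmax (n + eta) (p + eta) <= 5 * s) by (apply Rmax_lub; lra).
  set (e := 32 * eps * s + 3 * eta).
  assert (eps_p : 8 * eps * p <= 32 * eps * s) by nra.
  assert (eps_n : 8 * eps * n <= 32 * eps * s) by nra.
  assert (He0 : 0 <= e) by (unfold e; nra).
  destruct (gamma_propagation (fun t => p + eta - x t) (fun t => n + eta + x t)
    (fun t => - (- x t + (1 + eps) * f (x (t - h)))) (fun t => - x t + (1 + eps) * f (x (t - h)))
    T h kappa (s / 2) e z) with (n := S N) (t := ts) as [G _]; auto; try lra.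
  - intros t Ht. generalize (Bd t Ht). lra.
  - intros t Ht. split.
    + evar_last.
      { apply (is_derive_minus (fun _ => p + eta) x); [apply is_derive_const|apply HE; lra]. }
      unfold minus, plus, opp, zero; simpl. ring.
    + evar_last.
      { apply (is_derive_plus (fun _ => n + eta) x); [apply is_derive_const|apply HE; lra]. }
      unfold plus, zero; simpl. ring.
  - intros t Ht.
    generalize (deficit_ineq f b q L rho eps p n eta (x (t - h)) (x t) HF ltac:(lra) Heta np I1
      ltac:(lra) ltac:(lra) (Bd (t - h) ltac:(lra)) kappa ltac:(lra)
      (HkM _ M1)).
    unfold e. lra.
  - intros t Ht.
    generalize (deficit_ineq _ _ q L rho eps n p eta (- x (t - h)) (- x t)
      (feedback_opp _ _ _ _ _ HF) ltac:(lra) Heta pp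
      ltac:(cbv beta; rewrite Ropp_involutive; exact I2) ltac:(lra) ltac:(lra)
      ltac:(generalize (Bd (t - h) ltac:(lra)); lra) kappa ltac:(lra)
      (HkM _ M2)).
    rewrite !Ropp_involutive. unfold e. lra.
  - fold a. lra.
  - fold a in G.
    assert (D : 1 / (9 * a) <= gamma_density (S N) (ts - (z + a * h))).
    { apply gamma_density_lower; fold a; [lra|].
      apply Rle_trans with (2 := HN). apply pow_incr. lra. }
    assert (KN : / 2 <= kappa ^ S N).
    { apply Rle_trans with (1 - INR (S N) * (5 * L * s)).
      - fold a. lra.
      - apply pow_one_sub_ge. lra. }
    set (gd := gamma_density (S N) (ts - (z + a * h))) in *.
    set (kn := kappa ^ S N) in *.
    assert (A1 : s / (36 * a) <= kn * (s / 2) * gd).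
    { replace (s / (36 * a)) with (/ 2 * (s / 2) * (1 / (9 * a))) by (field; lra).
      assert (0 < 1 / (9 * a)) by (apply Rdiv_lt_0_compat; lra).
      apply Rmult_le_compat; [nra|lra| |exact D]. apply Rmult_le_compat_r; lra. }
    assert (A2 : (a + 1) * (32 * eps * s) <= s / (72 * a)).
    { apply (proj1 (Rle_div_r _ _ (72 * a) ltac:(lra))).
      replace ((a + 1) * (32 * eps * s) * (72 * a)) with (s * (2304 * eps * (a ^ 2 + a))) by ring.
      assert (eps * a <= eps * a ^ 2) by (apply Rmult_le_compat_l; nra).
      rewrite <- (Rmult_1_r s) at 2. apply Rmult_le_compat_l; lra. }
    (* In units of [s / (144 * a)] this reads [4 <= 2 + 1]. *)
    assert (A3 : s / (36 * a) <= s / (72 * a) + s / (144 * a)) by (unfold e in G; lra).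
    assert (0 < s / (144 * a)) by (apply Rdiv_lt_0_compat; lra).
    replace (s / (36 * a)) with (4 * (s / (144 * a))) in A3 by (field; lra).
    replace (s / (72 * a)) with (2 * (s / (144 * a))) in A3 by (field; lra).
    lra.
Qed.

(** With [eps = th^8] and [h <= 1 / th], the amplitude [s] is [O(th^4)] and the number of delays
    [O(th^(-2))]. Hence the total loss in [kappa] is [O(th^2)] and [eps * N^2] is [O(th^4)], both
    small. *)
Lemma stable_near_1 (f : R -> R) (b q L rho m : R) :
  feedback f b q L rho -> (forall y, continuity_pt f y) -> (forall y, m <= f y) ->
  exists W, 200 <= W /\ forall th h, 0 < th -> th * W <= 1 -> 0 <= h -> th * h <= 1 ->
    globally_stable f (1 + th ^ 8) h.
Proof.
  intros HF Hc Hm.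
  pose proof (fb_q _ _ _ _ _ HF) as Hq. pose proof (fb_L _ _ _ _ _ HF) as HL.
  pose proof (fb_rho _ _ _ _ _ HF) as Hr.
  set (c := 2 / q).
  assert (Hc2 : 0 < c) by (apply Rdiv_lt_0_compat; lra).
  assert (Hcq : c * q = 2) by (unfold c; field; lra).
  assert (W1 : 0 < 4 / q ^ 3) by (apply Rdiv_lt_0_compat; [lra|apply pow_lt; lra]).
  assert (W2 : 0 <= 8 * b ^ 2 / q).
  { apply Rdiv_le_0_compat; [|lra]. generalize (pow2_ge_0 b); lra. }
  assert (W3 : 0 <= 4 * c * Rabs b) by (apply Rmult_le_pos; [lra|apply Rabs_pos]).
  assert (W4 : 0 < 5 * c / rho) by (apply Rdiv_lt_0_compat; lra).
  assert (W5 : 0 <= 3240 * L * c) by (apply Rmult_le_pos; [apply Rmult_le_pos|]; lra).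
  (* Each summand secures one smallness condition: numerical constants, [2 * eps < q^3],
     [8 * b^2 * eps <= q], [4 * |b| * s <= 2], [5 * s <= rho], and the loss in [kappa]. Here
     [3240 = 5 * 2 * 18^2], where [18^2] bounds [th^2 * INR (S N)]. *)
  set (W := 200 + 4 / q ^ 3 + 8 * b ^ 2 / q + 4 * c * Rabs b + 5 * c / rho + 3240 * L * c).
  exists W. split; [unfold W; lra|].
  intros th h Hth HW Hh Hthh phi _ x Hx.
  assert (part : forall w, w <= W -> th * w <= 1).
  { intros w Hw. apply Rle_trans with (2 := HW). apply Rmult_le_compat_l; lra. }
  pose proof (part 200 ltac:(unfold W; lra)) as P0.
  pose proof (part (4 / q ^ 3) ltac:(unfold W; lra)) as P1.
  pose proof (part (8 * b ^ 2 / q) ltac:(unfold W; lra)) as P2.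
  pose proof (part (4 * c * Rabs b) ltac:(unfold W; lra)) as P3.
  pose proof (part (5 * c / rho) ltac:(unfold W; lra)) as P4.
  pose proof (part (3240 * L * c) ltac:(unfold W; lra)) as P5.
  set (eps := th ^ 8) in *.
  assert (T2 : 0 < th ^ 2 <= th) by nra.
  assert (T4 : 0 < th ^ 4 <= th ^ 2 / 40000).
  { replace (th ^ 4) with (th ^ 2 * th ^ 2) by ring.
    assert (th ^ 2 <= / 40000) by nra.
    split; [apply Rmult_lt_0_compat; lra|].
    apply Rmult_le_compat_l; lra. }
  assert (T8 : eps = th ^ 4 * th ^ 4) by (unfold eps; ring).
  assert (Eth : 0 < eps <= th / 8).
  { rewrite T8. split; [apply Rmult_lt_0_compat; lra|].
    apply Rle_trans with (th ^ 4 * 1); [apply Rmult_le_compat_l|]; lra. }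
  destruct (solution_limsups f b q L rho (1 + eps) h m phi x HF Hc Hm ltac:(lra) Hx)
    as (HE & p & n & Hp & Hn).
  destruct (limsups_recip f b q L rho (1 + eps) h x p n HF ltac:(lra) Hh HE Hp Hn)
    as [[Q1 Q2]|(pp & np & I1 & I2)].
  { eapply is_lim_of_limsup; eauto. }
  exfalso.
  destruct (recip_system_bounds b q eps p n) as (S1 & S2 & S3); auto; try lra.
  { apply Rle_lt_trans with (th / 4); [lra|].
    replace (q ^ 3) with (q ^ 3 * 1) by ring.
    assert (0 < q ^ 3) by (apply pow_lt; lra).
    assert (th * (4 / q ^ 3) * q ^ 3 <= q ^ 3) by nra.
    replace (th * (4 / q ^ 3) * q ^ 3) with (th * 4) in H0 by (field; lra). lra. }
  { assert (th * (8 * b ^ 2 / q) * q <= 1 * q) by (apply Rmult_le_compat_r; lra).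
    replace (th * (8 * b ^ 2 / q) * q) with (8 * b ^ 2 * th) in H by (field; lra).
    generalize (pow2_ge_0 b). nra. }
  set (s := Rmin p n) in *.
  assert (sp : 0 < s) by (apply Rmin_glb_lt; lra).
  assert (Hs : s <= c * th ^ 4).
  { apply Rsqr_incr_0_var; [|apply Rmult_le_pos; lra]. unfold Rsqr.
    replace (c * th ^ 4 * (c * th ^ 4)) with (c * c * eps) by (rewrite T8; ring).
    apply Rmult_le_reg_l with q; [lra|].
    replace (q * (c * c * eps)) with (2 * c * eps) by (rewrite <- Hcq; ring).
    assert (2 <= 2 * c) by nra. nra. }
  assert (Hs2 : s <= c * th ^ 2) by nra.
  assert (Hs1 : s <= c * th) by nra.
  assert (Hb : Rabs b * (4 * s) <= 2).
  { pose proof (Rabs_pos b). nra. }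
  assert (qn : 0 < q * Rmin n q) by (apply Rmult_lt_0_compat; [|apply Rmin_glb_lt]; lra).
  assert (qp : 0 < q * Rmin p q) by (apply Rmult_lt_0_compat; [|apply Rmin_glb_lt]; lra).
  destruct (ceil_succ ((h + 16) ^ 2)) as [N HN]; [apply pow2_ge_0|].
  assert (HN2 : th ^ 2 * INR (S N) <= 324).
  { apply Rle_trans with (th ^ 2 * ((h + 17) ^ 2)).
    - apply Rmult_le_compat_l; [lra|]. nra.
    - replace (th ^ 2 * (h + 17) ^ 2) with ((th * h + 17 * th) ^ 2) by ring.
      replace 324 with (18 ^ 2) by ring. apply pow_incr. nra. }
  assert (N0 : 0 < INR (S N)) by (apply lt_0_INR; lia).
  apply (no_oscillation f b q L rho eps h p n N x HF); auto; try lra.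
  - apply (feedback_twice_le f b q L rho eps p n HF); auto; try lra.
    apply Rle_trans with (2 := Hb). apply Rmult_le_compat_l; [apply Rabs_pos|lra].
  - generalize (feedback_twice_le _ (- b) q L rho eps n p (feedback_opp _ _ _ _ _ HF)).
    rewrite Ropp_involutive. intros K. apply K; auto; try lra.
    rewrite Rabs_Ropp.
    apply Rle_trans with (2 := Hb). apply Rmult_le_compat_l; [apply Rabs_pos|lra].
  - fold s. apply Rle_trans with (5 * (c * th)); [lra|].
    assert (th * (5 * c / rho) * rho <= 1 * rho) by (apply Rmult_le_compat_r; lra).
    replace (th * (5 * c / rho) * rho) with (5 * (c * th)) in H by (field; lra). lra.
  - fold s. apply Rle_trans with (INR (S N) * (5 * L * (c * th ^ 4))).
    + apply Rmult_le_compat_l; [lra|]. apply Rmult_le_compat_l; nra.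
    + replace (INR (S N) * (5 * L * (c * th ^ 4))) with (th ^ 2 * INR (S N) * (5 * L * c * th ^ 2)) by ring.
      assert (0 <= L * c) by (apply Rmult_le_pos; lra).
      assert (5 * L * c * th ^ 2 <= / 648).
      { apply Rle_trans with (5 * (th * (L * c))); [|lra].
        replace (5 * L * c * th ^ 2) with (5 * (th ^ 2 * (L * c))) by ring.
        apply Rmult_le_compat_l; [lra|]. apply Rmult_le_compat_r; lra. }
      assert (0 <= 5 * L * c * th ^ 2).
      { replace (5 * L * c * th ^ 2) with (5 * (th ^ 2 * (L * c))) by ring.
        apply Rmult_le_pos; [lra|]. apply Rmult_le_pos; lra. }
      apply Rle_trans with (324 * (5 * L * c * th ^ 2)); [apply Rmult_le_compat_r|]; lra.
  - replace (4608 * eps * INR (S N) ^ 2) with (4608 * th ^ 4 * (th ^ 2 * INR (S N)) ^ 2)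
      by (unfold eps; ring).
    assert ((th ^ 2 * INR (S N)) ^ 2 <= 324 ^ 2).
    { apply pow_incr. split; [apply Rmult_le_pos; lra|exact HN2]. }
    assert (th ^ 4 <= / 1600000000).
    { assert (th ^ 2 <= / 40000) by nra. lra. }
    nra.
Qed.

(** * The stability boundary *)

Lemma eighth_root (y : R) :
  0 < y -> exists th, 0 < th /\ th ^ 8 = y /\ Rpower y (- (1 / 8)) = / th.
Proof.
  intros Hy. exists (Rpower y (1 / 8)). split; [apply exp_pos|split].
  - rewrite <- Rpower_pow by apply exp_pos. rewrite Rpower_mult.
    replace (1 / 8 * INR 8) with 1 by (simpl; field). now apply Rpower_1.
  - apply Rpower_Ropp.
Qed.

Lemma eighth_pow_le_inv (x y : R) : 0 <= x -> 0 <= y -> x ^ 8 <= y ^ 8 -> x <= y.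
Proof.
  intros Hx Hy H. destruct (Rle_lt_dec x y) as [K|K]; [exact K|exfalso].
  assert (y * y < x * x) by nra.
  assert (y * y * (y * y) < x * x * (x * x)) by nra.
  assert (0 <= y * y * (y * y)) by nra.
  replace (x ^ 8) with (x * x * (x * x) * (x * x * (x * x))) in H by ring.
  replace (y ^ 8) with (y * y * (y * y) * (y * y * (y * y))) in H by ring.
  nra.
Qed.

(** The sixteenth power of [exp (- t) <= 1 / t] at [t = 1 / (16 * th)]. The exponent makes the bound
    quadratic in [th^8 = zeta - 1]. *)
Lemma exp_neg_inv_le (th : R) : 0 < th -> exp (- / th) <= 16 ^ 16 * (th ^ 8) ^ 2.
Proof.
  intros H. set (t := / (16 * th)).
  assert (Ht : 0 < t) by (apply Rinv_0_lt_compat; lra).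
  replace (- / th) with (INR 16 * - t) by (unfold t; simpl; field; lra).
  rewrite <- pow_exp. replace (16 ^ 16 * (th ^ 8) ^ 2) with ((16 * th) ^ 16) by ring.
  apply pow_incr. split; [left; apply exp_pos|].
  rewrite exp_Ropp. replace (16 * th) with (/ t) by (unfold t; rewrite Rinv_inv; reflexivity).
  apply Rinv_le_contravar; [exact Ht|]. generalize (exp_ineq1_le t). lra.
Qed.

(** The member [nu] and the lower bound [0] exclude infinite values of [Glb_Rbar], which [real]
    would send to [0]. *)
Lemma Gamma_bounds (f : R -> R) (mu nu : R) :
  0 <= nu ->
  (forall nu', nu < nu' -> 0 < nu' <= mu -> stability_domain f mu nu') ->
  0 <= Gamma f mu <= nu.
Proof.
  intros H0 HD. unfold Gamma.
  match goal with |- context [Glb_Rbar ?E] => destruct (Glb_Rbar_correct E) as [G1 G2];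
    generalize (G1 nu (conj H0 HD)); generalize (G2 (Finite 0) (fun x Hx => proj1 Hx));
    destruct (Glb_Rbar E) end; simpl; tauto.
Qed.

Lemma stability_domain_intro (f : R -> R) (mu nu : R) :
  0 < nu <= mu -> (0 <= - ln (nu / mu) -> globally_stable f (1 / mu) (- ln (nu / mu))) ->
  stability_domain f mu nu.
Proof.
  intros H HS. exists (1 / mu), (- ln (nu / mu)).
  assert (P : 0 < nu / mu) by (apply Rdiv_lt_0_compat; lra).
  assert (L : 0 <= - ln (nu / mu)).
  { assert (ln (nu / mu) <= ln 1); [|rewrite ln_1 in *; lra].
    apply ln_le; [exact P|]. apply Rle_div_l; lra. }
  repeat split; auto.
  - apply Rdiv_lt_0_compat; lra.
  - field; lra.
  - rewrite Ropp_involutive, exp_ln by exact P. field; lra.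
Qed.

Lemma is_derive_0_of_quadratic (F : R -> R) (a C d : R) :
  0 < d -> 0 <= C -> (forall k, Rabs k < d -> Rabs (F (a + k) - F a) <= C * k ^ 2) ->
  is_derive F a 0.
Proof.
  intros Hd HC HF. apply is_derive_Reals. intros e He.
  assert (P : 0 < Rmin d (e / (C + 1))).
  { apply Rmin_glb_lt; [exact Hd|]. apply Rdiv_lt_0_compat; lra. }
  exists (mkposreal _ P). intros k Hk0 Hk. simpl in Hk.
  pose proof (Rmin_l d (e / (C + 1))). pose proof (Rmin_r d (e / (C + 1))).
  pose proof (Rabs_pos_lt k Hk0).
  rewrite Rminus_0_r. unfold Rdiv. rewrite Rabs_mult, Rabs_inv.
  apply Rle_lt_trans with (C * Rabs k).
  - apply Rmult_le_reg_r with (Rabs k); [assumption|].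
    rewrite Rmult_assoc, Rinv_l, Rmult_1_r by lra.
    replace (C * Rabs k * Rabs k) with (C * k ^ 2) by (rewrite <- (pow2_abs k); ring).
    apply HF. lra.
  - apply Rle_lt_trans with ((C + 1) * Rabs k); [nra|].
    replace e with ((C + 1) * (e / (C + 1))) by (field; lra).
    apply Rmult_lt_compat_l; lra.
Qed.

(** [Gamma] vanishes for [mu >= 1], where [zeta <= 1]. For [mu < 1], stability up to [h = 1 / th]
    gives [Gamma f mu <= exp (- 1 / th)], which is quadratic in [1 - mu]. *)
Lemma Gamma_is_derive (f : R -> R) (W : R) :
  1 <= W ->
  (forall zeta h, 0 < zeta <= 1 -> 0 <= h -> globally_stable f zeta h) ->
  (forall th h, 0 < th -> th * W <= 1 -> 0 <= h -> th * h <= 1 ->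
    globally_stable f (1 + th ^ 8) h) ->
  is_derive (Gamma f) 1 0.
Proof.
  intros HW Hle Hgt.
  assert (G0 : forall mu, 1 <= mu -> Gamma f mu = 0).
  { intros mu Hmu. apply Rle_antisym; apply (Gamma_bounds f mu 0 (Rle_refl 0));
    intros nu' _ Hnu; apply stability_domain_intro; auto; apply Hle;
    (split; [apply Rdiv_lt_0_compat; lra|apply Rle_div_l; lra]). }
  assert (HW8 : 0 < / W ^ 8) by (apply Rinv_0_lt_compat, pow_lt; lra).
  (* [|k| < 1/2] gives [beta <= 2 * |k|], the source of the factor [4]; [|k| < 1 / (2 * W^8)] then
     gives [th <= 1 / W]. *)
  apply (is_derive_0_of_quadratic _ 1 (4 * 16 ^ 16) (Rmin (/ 2) (/ 2 * / W ^ 8))).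
  - apply Rmin_glb_lt; lra.
  - apply Rmult_le_pos; [lra|apply pow_le; lra].
  - intros k Hk. pose proof (Rmin_l (/ 2) (/ 2 * / W ^ 8)). pose proof (Rmin_r (/ 2) (/ 2 * / W ^ 8)).
    assert (P16 : 0 < 16 ^ 16) by (apply pow_lt; lra).
    rewrite (G0 1) by lra. rewrite Rminus_0_r.
    destruct (Rle_lt_dec 0 k) as [K|K].
    { rewrite G0 by lra. rewrite Rabs_R0. apply Rmult_le_pos; [lra|apply pow2_ge_0]. }
    rewrite Rabs_left in Hk by exact K.
    set (mu := 1 + k) in *. assert (Hmu : / 2 < mu < 1) by (unfold mu; lra).
    set (beta := 1 / mu - 1).
    assert (Hb : 0 < beta <= 2 * - k).
    { replace beta with (- k * / mu) by (unfold beta, mu; field; unfold mu in Hmu; lra).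
      assert (1 < / mu <= 2).
      { split; [rewrite <- Rinv_1; apply Rinv_lt_contravar; lra|].
        rewrite <- (Rinv_inv 2). apply Rinv_le_contravar; lra. }
      nra. }
    destruct (eighth_root beta) as (th & T0 & T8 & _); [lra|].
    assert (TW : th * W <= 1).
    { assert (th <= / W).
      { apply eighth_pow_le_inv; [lra|left; apply Rinv_0_lt_compat; lra|].
        rewrite T8, pow_inv. lra. }
      apply Rle_trans with (/ W * W); [apply Rmult_le_compat_r; lra|rewrite Rinv_l; lra]. }
    assert (B : 0 <= Gamma f mu <= exp (- / th)).
    { apply Gamma_bounds; [left; apply exp_pos|]. intros nu Hnu Hnu'.
      apply stability_domain_intro; [exact Hnu'|]. intros Hh.
      replace (1 / mu) with (1 + th ^ 8) by (rewrite T8; unfold beta; ring).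
      apply Hgt; auto.
      assert (- / th <= ln (nu / mu)).
      { rewrite <- (ln_exp (- / th)). apply ln_le; [apply exp_pos|].
        apply (proj1 (Rle_div_r _ _ mu ltac:(lra))). generalize (exp_pos (- / th)). nra. }
      apply Rle_trans with (th * / th); [apply Rmult_le_compat_l; lra|rewrite Rinv_r; lra]. }
    rewrite Rabs_pos_eq by lra.
    apply Rle_trans with (1 := proj2 B).
    apply Rle_trans with (1 := exp_neg_inv_le th T0). rewrite T8.
    replace (4 * 16 ^ 16 * k ^ 2) with (16 ^ 16 * (2 * - k) ^ 2) by ring.
    apply Rmult_le_compat_l; [lra|]. apply pow_incr. lra.
Qed.

Theorem theorem6 (f : R -> R)
  (hC3 : class_C3 f) (h1 : H1 f) (h2 : H2 f) (h3 : H3 f) :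
  (exists eps K : R, 0 < eps /\ 0 < K /\
    forall zeta h : R,
      0 <= zeta - 1 <= eps ->
      0 <= h ->
      (zeta = 1 \/ h < K * Rpower (zeta - 1) (- (1 / 8))) ->
      globally_stable f zeta h) /\
  is_derive (Gamma f) 1 0.
Proof.
  destruct (feedback_intro f hC3 h1 h2 h3) as (b & q & L & rho & HF).
  assert (Hc : forall y, continuity_pt f y).
  { intros y. eapply is_derive_continuity_pt, (proj1 (class_C3_derivatives f hC3)). }
  destruct (proj1 h2) as [m Hm].
  assert (Hle : forall zeta h, 0 < zeta <= 1 -> 0 <= h -> globally_stable f zeta h).
  { intros zeta h Hz Hh. eapply stable_le_1; eauto. }
  destruct (stable_near_1 f b q L rho m HF Hc Hm) as (W & HW & Hgt).
  split; [|apply (Gamma_is_derive f W); auto; lra].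
  (* With [th] the eighth root of [zeta - 1], these choices turn the two bounds into [th * W <= 1]
     and [th * h <= 1]. *)
  exists (/ W ^ 8), 1. split; [apply Rinv_0_lt_compat, pow_lt; lra|split; [lra|]].
  intros zeta h Hz Hh Hc'.
  destruct (Rle_lt_dec zeta 1) as [K|K]; [apply Hle; lra|].
  destruct Hc' as [->|Hc']; [lra|].
  destruct (eighth_root (zeta - 1)) as (th & T0 & T8 & E); [lra|].
  rewrite E, Rmult_1_l in Hc'.
  replace zeta with (1 + th ^ 8) by lra.
  apply Hgt; auto.
  - assert (th <= / W).
    { apply eighth_pow_le_inv; [lra|left; apply Rinv_0_lt_compat; lra|].
      rewrite T8, pow_inv. lra. }
    apply Rle_trans with (/ W * W); [apply Rmult_le_compat_r; lra|rewrite Rinv_l; lra].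
  - apply Rle_trans with (th * / th); [apply Rmult_le_compat_l; lra|rewrite Rinv_r; lra].
Qed.
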